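(* Let $\alpha\in\mathbb{Q}^n$, let $s\in C^2(\mathbb{R}^{B_{\mathbf 0}^r},\mathbb{R})$ be admissible, and suppose there are adjacent $v_0^\alpha,w_0^\alpha\in\mathcal{N}_0^{\alpha}$ with $v_0^\alpha<w_0^\alpha$. Then there is a solution of the Euler–Lagrange equation of the form $\mathbf{i}\mapsto U_1^\alpha(\mathbf{i})+\alpha\cdot\mathbf{i}$ with $U_1^\alpha\in\mathcal{M}_1^\alpha=\mathcal{M}_1^\alpha(v_0^\alpha,w_0^\alpha)$. Moreover, $\mathcal{M}_1^\alpha$ is an ordered set, for every $U\in\mathcal{M}_1^\alpha$ the configuration $\mathbf{i}\mapsto U(\mathbf{i})+\alpha\cdot\mathbf{i}$ is a solution of the Euler–Lagrange equation, and every $U\in\mathcal{M}_1^\alpha$ is strictly $\mathbf{r}_1$-monotone in $\mathbf{i}_1$, i.e. $U<\tau^1_{-\mathbf{r}_1}U$.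
   Context: Fix integers $n\ge 1$, $r\ge 1$. For $\mathbf{i}\in\mathbb{Z}^n$ let $\|\mathbf{i}\|=\sum_k|\mathbf{i}_k|$, and $B_{\mathbf 0}^r=\{\mathbf{k}\in\mathbb{Z}^n:\|\mathbf{k}\|\le r\}$; $\mathbf{e}_1,\dots,\mathbf{e}_n$ are the standard unit vectors. A function $s\in C^2(\mathbb{R}^{B_{\mathbf 0}^r},\mathbb{R})$ is called admissible if: (S1) $s(u+1_{B_{\mathbf 0}^r})=s(u)$, with $1_{B_{\mathbf 0}^r}$ the constant function $1$; (S2) $s$ is bounded from below and $s(u)\to\infty$ as $|u(\mathbf{k})-u(\mathbf{j})|\to\infty$, for $\mathbf{k},\mathbf{j}\in B_{\mathbf 0}^r$ with $\|\mathbf{k}-\mathbf{j}\|=1$; (S3) $\partial_{\mathbf{k},\mathbf{j}}s\le 0$ for $\mathbf{k}\ne\mathbf{j}$ in $B_{\mathbf 0}^r$, and $\partial_{\mathbf{0},\mathbf{j}}s<0$ for $\|\mathbf{j}\|=1$. A configuration is a function $u:\mathbb{Z}^n\to\mathbb{R}$. Shifts: $(\tau^j_{-k}u)(\mathbf{i})=u(\mathbf{i}+k\mathbf{e}_j)$ for $k\in\mathbb{Z}$. Local potentials: $S_{\mathbf{j}}(u)=s\big((\tau^n_{-\mathbf{j}_n}\cdots\tau^1_{-\mathbf{j}_1}u)|_{B_{\mathbf 0}^r}\big)$. A solution of the Euler–Lagrange equation is a configuration $u$ with $\sum_{\mathbf{j}:\|\mathbf{j}-\mathbf{i}\|\le r}\partial_{\mathbf{i}}S_{\mathbf{j}}(u)=0$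 for all $\mathbf{i}\in\mathbb{Z}^n$, where $\partial_{\mathbf i}$ is the partial derivative with respect to $u(\mathbf i)$. Orders: $u\le v$ (resp. $u<v$) means $u(\mathbf{i})\le v(\mathbf{i})$ (resp. $u(\mathbf{i})<v(\mathbf{i})$) for all $\mathbf{i}$. A set of configurations is ordered if any two members $u,v$ satisfy $u<v$, $u=v$ or $u>v$. Members $v<w$ of a set $A$ of configurations are adjacent in $A$ if there is no $u\in A$ with $v\le u\le w$, $u\neq v$, $u\ne w$. For $E\subset\mathbb{Z}^n$, $\|u\|_E=\sum_{\mathbf{j}\in E}|u(\mathbf{j})|$. For $\alpha\in\mathbb{Q}^n$ write $\alpha_k=\mathbf{s}_k/\mathbf{r}_k$ with $\mathbf{r}\in\mathbb{N}^n$ (positive entries), $\mathbf{s}\in\mathbb{Z}^n$, and $\mathbf{r}_k,\mathbf{s}_k$ relatively prime. $u+\alpha\cdot\mathbf{i}$ denotes the configuration $\mathbf{i}\mapsto u(\mathbf{i})+\alpha\cdot\mathbf{i}$. Let $\Gamma_0(\mathbf{r})$ be the set of configurations with $u(\mathbf{i}+\mathbf{r}_k\mathbf{e}_k)=u(\mathbf{i})$ for $1\le k\le n$, $J_0^{\mathbf{r}}(u)=\sum_{0\le\mathbf{j}_k<\mathbf{r}_k,\,1\le k\le n}S_{\mathbf{j}}(u)$, $c_0^\alpha=\inf_{u\in\Gamma_0(\mathbf{r})}J_0^{\mathbf{r}}(u+\alpha\cdot\mathbf{i})$, and $\mathcal{N}_0^\alpha=\{u\in\Gamma_0(\mathbf{r}):J_0^{\mathbf{r}}(u+\alpha\cdot\mathbf{i})=c_0^\alpha\}$.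 Put $\mathbb{T}_i^\alpha=\{i\mathbf{r}_1,\dots,(i+1)\mathbf{r}_1-1\}\times\{0,\dots,\mathbf{r}_2-1\}\times\cdots\times\{0,\dots,\mathbf{r}_n-1\}$ for $i\in\mathbb{Z}$. For $v<w$ in $\mathcal{N}_0^\alpha$: $\hat\Gamma_1^\alpha(v,w)$ is the set of configurations $u$ with $v\le u\le w$ and $u(\mathbf{i}+\mathbf{r}_k\mathbf{e}_k)=u(\mathbf{i})$ for $2\le k\le n$; $J^\alpha_{1,i}(u)=\sum_{\mathbf{j}\in\mathbb{T}_i^\alpha}S_{\mathbf{j}}(u+\alpha\cdot\mathbf{i})-c_0^\alpha$; $J_{1;p,q}^\alpha=\sum_{i=p}^qJ_{1,i}^\alpha$; $J_1^\alpha(u)=\liminf_{p\to-\infty,\,q\to\infty}J^\alpha_{1;p,q}(u)$; $\Gamma_1^\alpha(v,w)=\{u\in\hat\Gamma_1^\alpha(v,w):\|u-v\|_{\mathbb{T}_i^\alpha}\to0\ (i\to-\infty),\ \|u-w\|_{\mathbb{T}_i^\alpha}\to0\ (i\to\infty)\}$; $c_1^\alpha=\inf_{\Gamma_1^\alpha(v_0^\alpha,w_0^\alpha)}J_1^\alpha$; $\mathcal{M}_1^\alpha(v_0^\alpha,w_0^\alpha)=\{u\in\Gamma_1^\alpha(v_0^\alpha,w_0^\alpha):J_1^\alpha(u)=c_1^\alpha\}$. *)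

(* Defs.v *)
From HB Require Import structures.
From mathcomp Require Import all_boot all_order all_algebra finmap.
From mathcomp Require Import all_classical all_reals all_analysis.
Import Order.TTheory GRing.Theory Num.Theory.
Import numFieldNormedType.Exports.

Set Implicit Arguments.
Unset Strict Implicit.
Unset Printing Implicit Defensive.

Local Open Scope classical_set_scope.
Local Open Scope ring_scope.

Section PartialDerivatives.
Context {R : realType} {I : choiceType}.
Implicit Types (f : (I -> R) -> R) (u : I -> R).

(* [dfwith u t] (at index [i]) is [u] with its value at [i] replaced by [t].
   The index type may be infinite: these partial derivatives are used both on
   R^B (B finite) and on the space of all configurations on Z^n. *)
Definition has_partial (i : I) f u : Prop :=
  derivable (fun t : R => f (@dfwith I (fun=> R) u i t)) (u i) 1.

Definition partial (i : I) f u : R :=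
  derive1 (fun t : R => f (@dfwith I (fun=> R) u i t)) (u i).

(* For finite [I] the pointwise topology is the usual one on R^I. *)
Fixpoint class_C (m : nat) f : Prop :=
  continuous (f : {ptws I -> R} -> R) /\
  (if m is m'.+1 then
     forall i, (forall u, has_partial i f u) /\ class_C m' (partial i f)
   else True).

End PartialDerivatives.

(* The lattice Z^n with n >= 1 is ['rV[int]_n.+1] (its dimension is [n.+1]);
   the first coordinate direction has index [ord0]. *)
Section Lattice.
Context {n : nat}.
Local Notation Zn := 'rV[int]_n.+1.

Definition norm1 (i : Zn) : int := \sum_(k < n.+1) `|i 0 k|.

Definition evec (k : 'I_n.+1) : Zn := delta_mx 0 k.

Definition lball (i : Zn) (r : nat) : set Zn := [set j | norm1 (j - i) <= r%:Z].

Lemma finite_box (a b : 'I_n.+1 -> int) :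
  finite_set [set j : Zn | forall k, a k <= j 0 k <= b k].
Proof.
pose N := \max_(k < n.+1) absz (b k - a k).
pose g (f : {ffun 'I_n.+1 -> 'I_N.+1}) : Zn := \row_k (a k + (f k)%:Z).
apply: (@sub_finite_set _ _ (range g)); last exact/finite_image/finite_finset.
move=> j /= jab; exists [ffun k => inord (absz (j 0 k - a k)%R)] => //.
apply/rowP => k; rewrite mxE ffunE /=.
have /andP[ak kb] := jab k.
have dk : (absz (j 0 k - a k)%R)%:Z = j 0 k - a k.
  by rewrite abszE ger0_norm ?subr_ge0.
rewrite inordK; first by rewrite dk addrC subrK.
rewrite ltnS; apply: leq_trans (leq_bigmax k).
rewrite -lez_nat dk abszE; apply: le_trans (ler_norm _).
by rewrite lerD2r.
Qed.

Lemma finite_int_itv (p q : int) : finite_set [set i : int | p <= i <= q].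
Proof.
apply: (@sub_finite_set _ _ (range (fun k : 'I_(absz (q - p)).+1 => p + k%:Z))).
  move=> i /= /andP[pi iq].
  have di : (absz (i - p))%:Z = i - p by rewrite abszE ger0_norm ?subr_ge0.
  have ik : (absz (i - p) < (absz (q - p)).+1)%N.
    rewrite ltnS -lez_nat di abszE; apply: le_trans (ler_norm _).
    by rewrite lerD2r.
  by exists (Ordinal ik) => //=; rewrite di addrC subrK.
exact/finite_image/finite_finset.
Qed.

Lemma finite_lball (i : Zn) (r : nat) : finite_set (lball i r).
Proof.
apply: sub_finite_set (finite_box (fun k => i 0 k - r%:Z)
                                  (fun k => i 0 k + r%:Z)).
move=> j /= ji k; rewrite -ler_distlC distrC.
apply: le_trans ji; rewrite /norm1 (bigD1 k)//= !mxE lerDl.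
by apply: sumr_ge0 => l _; exact: normr_ge0.
Qed.

Definition B0 (r : nat) : {fset Zn} := fset_set (lball 0 r).

Lemma in_B0 (r : nat) (k : Zn) : (k \in B0 r) = (norm1 k <= r%:Z).
Proof.
rewrite in_fset_set; last exact: finite_lball.
by apply/idP/idP; rewrite inE /lball /= subr0.
Qed.

End Lattice.

Section Configurations.
Context {R : realType} {n : nat}.
Local Notation Zn := 'rV[int]_n.+1.
Local Notation conf := (Zn -> R).
Implicit Types (u v w : conf) (A : set conf).

Definition cle u v : Prop := forall i, u i <= v i.
(* Pointwise strict, as opposed to "[cle u v] and [u <> v]". *)
Definition clt u v : Prop := forall i, u i < v i.

Definition cordered A : Prop :=
  forall u v, A u -> A v -> [\/ clt u v, u = v | clt v u].

Definition adjacent_in A v w : Prop :=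
  [/\ A v, A w, clt v w &
      ~ exists u, [/\ A u, cle v u, cle u w, u <> v & u <> w]].

(* [tau k m u] is $\tau^k_{-m}u$. *)
Definition tau (k : 'I_n.+1) (m : int) u : conf := fun i => u (i + m *: evec k).

(* $\tau^n_{-j_n}\cdots\tau^1_{-j_1}u$ *)
Definition taus (j : Zn) u : conf :=
  foldl (fun v k => tau k (j 0 k) v) u (enum 'I_n.+1).

Lemma tausE (j : Zn) u i : taus j u i = u (i + j).
Proof.
rewrite /taus.
have H (ks : seq 'I_n.+1) v : foldl (fun v k => tau k (j 0 k) v) v ks i =
    v (i + \sum_(k <- ks) j 0 k *: evec k).
  elim: ks v => [|k ks IH] v /=; first by rewrite big_nil addr0.
  by rewrite IH /tau big_cons -addrA (addrC (\sum_(_ <- _) _)).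
by rewrite H big_enum /= -row_sum_delta.
Qed.

Definition l1on (E : set Zn) u : R := \sum_(j \in E) `|u j|.

Definition tilt (alpha : 'rV[rat]_n.+1) u : conf :=
  fun i => u i + \sum_(k < n.+1) ratr (alpha 0 k) * (i 0 k)%:~R.

End Configurations.

Section Potential.
Context {R : realType} {n r : nat}.
Local Notation Zn := 'rV[int]_n.+1.
Local Notation conf := (Zn -> R).
Local Notation B := (B0 (n := n) r).
Variable s : (B -> R) -> R.

Definition S1 : Prop := forall u : B -> R, s (fun k => u k + 1) = s u.

Definition S2 : Prop :=
  (exists m : R, forall u, m <= s u) /\
  (forall k j : B, norm1 (val k - val j) = 1 ->
     forall M : R, \forall C \near +oo, forall u, C <= `|u k - u j| -> M <= s u).

Definition S3 : Prop :=
  (forall k j : B, k != j -> forall u, partial k (partial j s) u <= 0) /\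
  (forall o j : B, val o = 0 -> norm1 (val j) = 1 ->
     forall u, partial o (partial j s) u < 0).

Definition admissible : Prop := [/\ class_C 2 s, S1, S2 & S3].

Definition Sloc (j : Zn) (u : conf) : R := s (fun k : B => taus j u (val k)).

Definition EL_solution (u : conf) : Prop :=
  forall i : Zn, \sum_(j \in lball i r) partial i (Sloc j) u = 0.

Variable alpha : 'rV[rat]_n.+1.

(* [denq] is the positive denominator of the fraction in lowest terms. *)
Definition per (k : 'I_n.+1) : int := denq (alpha 0 k).

Definition periodic_in (k : 'I_n.+1) (u : conf) : Prop :=
  forall i, u (i + per k *: evec k) = u i.

Definition Gamma0 : set conf := [set u | forall k, periodic_in k u].

Definition box0 : set Zn := [set j | forall k, 0 <= j 0 k < per k].

Definition J0 (u : conf) : R := \sum_(j \in box0) Sloc j u.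

Definition c0 : R := inf [set J0 (tilt alpha u) | u in Gamma0].

Definition N0 : set conf := [set u | Gamma0 u /\ J0 (tilt alpha u) = c0].

Definition T1 (i : int) : set Zn :=
  [set j | i * per ord0 <= j 0 ord0 < (i + 1) * per ord0 /\
           forall k, k != ord0 -> 0 <= j 0 k < per k].

Lemma finite_box0 : finite_set box0.
Proof.
apply: sub_finite_set (finite_box (fun=> 0) per) => j /= jP k.
by have /andP[-> /ltW ->] := jP k.
Qed.

Lemma finite_T1 (i : int) : finite_set (T1 i).
Proof.
apply: sub_finite_set
  (finite_box (fun k => if k == ord0 then i * per ord0 else 0)
              (fun k => if k == ord0 then (i + 1) * per ord0 else per k)).
move=> j /= [/andP[j0 j1] jP] k; case: ifPn => [/eqP ->|/jP /andP[-> /ltW ->]//].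
by rewrite j0 ltW.
Qed.

Definition J1i (i : int) (u : conf) : R :=
  \sum_(j \in T1 i) Sloc j (tilt alpha u) - c0.

Definition J1pq (p q : int) (u : conf) : R :=
  \sum_(i \in [set i : int | p <= i <= q]) J1i i u.

(* The two indices p = - x.1 and q = x.2 tend to -oo and +oo independently;
   the value is an extended real. *)
Definition J1 (u : conf) : \bar R :=
  limf_einf (fun x : nat * nat => (J1pq (- x.1%:Z) x.2%:Z u)%:E)
            (filter_prod \oo \oo).

Definition hatGamma1 (v w : conf) : set conf :=
  [set u | [/\ cle v u, cle u w & forall k, k != ord0 -> periodic_in k u]].

Definition Gamma1 (v w : conf) : set conf :=
  [set u | [/\ hatGamma1 v w u,
    (fun m : nat => l1on (T1 (- m%:Z)) (fun i => u i - v i)) @ \oo --> (0 : R) &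
    (fun m : nat => l1on (T1 m%:Z) (fun i => u i - w i)) @ \oo --> (0 : R)]].

Definition c1 (v w : conf) : \bar R := ereal_inf [set J1 u | u in Gamma1 v w].

Definition M1 (v w : conf) : set conf := [set u | Gamma1 v w u /\ J1 u = c1 v w].

End Potential.

(* Main.v *)
Require Import Defs.
From mathcomp Require Import all_boot all_order all_algebra finmap.
From mathcomp Require Import all_classical all_reals all_analysis.
From mathcomp Require Import zify ring lra.
Import Order.TTheory GRing.Theory Num.Theory.
Import numFieldNormedType.Exports.

(** Everything rests on submodularity: since the mixed second partials of the
potential are nonpositive, its values at the pointwise minimum and maximum of
two configurations add up to at most the sum of its two values
([submodular_of_partials]). A configuration that is periodic in all directions
but the first is a stack of layers indexed by the integers, and the energies
of the layers inherit submodularity.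

Lower bounds. An excursion, that is a stack which leaves a ground state [z]
(here [v0] or [w0]) only in a finite window, has energy at least that of [z].
Continue the window periodically with period 2^k. The minimum and the maximum
of such a stack and of its translate by half a period have half the period, and
their energies per period add up to at most its own; after [k] halvings only
translation invariant stacks remain, whose energy is nonnegative because [c0]
is an infimum ([periodic_block_ge0], [excursion_ge0]). Cutting a stack where
it is close to a ground state costs little, so the partial sums of [J1] along
a connection from [v0] to [w0] are almost increasing and [J1] is their limit.

Existence. Minimise first among the stacks equal to [v0] below a window and to
[w0] above it. The smallest minimiser [u] increases along the first direction:
its minimum with its translate is admissible for the same window, their
maximum for the translated window, so both are minimisers
([monotone_minimizer]). Translated so that they cross the middle of the gap at
a fixed site, almost optimal monotone stacks have a cluster point. It is
monotone, hence has limits at both ends; these are invariant of energy zero,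
so they are [v0] and [w0] because no other ground state lies between them, and
gluing shows that the energy of the cluster point is optimal
([minimal_exists]).

Euler-Lagrange equation. A minimiser may be compared only with configurations
of the same periodicity, which change a whole orbit of sites at once. By
submodularity the cost of raising a set of sites by one common amount is at
most the sum of the costs of raising them one by one; by periodicity this sum
is the cost of a single raise in the full lattice ([raise_block_le]), a
function of one variable whose derivative is the left-hand side of the
equation. Where a minimiser touches [v0] only upward perturbations are
allowed, but there the missing inequality follows by comparison with [v0],
itself a solution ([minimal_EL]).

Order. The minimum and the maximum of two minimisers are minimisers, and two
ordered solutions which agree at one site agree everywhere, because the
coupling between neighbouring sites is strict ([EL_comparison]). So minimisers
are ordered ([minimal_ordered]); comparing a minimiser with its own translate
leaves only strict increase, since it runs from [v0] up to [w0]
([minimal_increasing]). *)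

Set Implicit Arguments.
Unset Strict Implicit.
Unset Printing Implicit Defensive.

Local Open Scope classical_set_scope.
Local Open Scope ring_scope.

(** * Stacks of layers with submodular energies *)

(** The one-dimensional skeleton of the problem. A site [x] belongs to the
layer [layer x], the translation [slide m] raises layers by [m], and [energy i]
depends only on the layers within distance [reach] of [i]. The energies are
normalised so that [energy_ge0], the minimality of [c0] among invariant
configurations, reads [0 <= energy 0 u]. The closure properties of [allowed]
are those which periodicity inside the layers has. *)
Record layered (R : realType) (I : choiceType) := Layered {
  layer : I -> int;
  slide : int -> I -> I;
  slide0 : forall x, slide 0 x = x;
  slideD : forall m k x, slide m (slide k x) = slide (m + k) x;
  layer_slide : forall m x, layer (slide m x) = layer x + m;
  reach : nat;
  energy : int -> (I -> R) -> R;
  energy_slide : forall i m u,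
    energy i (fun x => u (slide m x)) = energy (i + m) u;
  energy_local : forall i u u',
    (forall x, i - reach%:Z <= layer x <= i + reach%:Z -> u x = u' x) ->
    energy i u = energy i u';
  energy_submodular : forall i u u',
    energy i (fun x => Num.min (u x) (u' x)) +
    energy i (fun x => Num.max (u x) (u' x)) <= energy i u + energy i u';
  allowed : set (I -> R);
  allowed_min : forall u u', allowed u -> allowed u' ->
    allowed (fun x => Num.min (u x) (u' x));
  allowed_max : forall u u', allowed u -> allowed u' ->
    allowed (fun x => Num.max (u x) (u' x));
  allowed_glue : forall p u u', allowed u -> allowed u' ->
    allowed (fun x => if layer x < p then u x else u' x);
  allowed_reindex : forall (f : int -> int) u, allowed u ->
    allowed (fun x => u (slide (f (layer x)) x));
  energy_ge0 : forall u, allowed u -> (forall x, u (slide 1 x) = u x) ->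
    0 <= energy 0 u }.

Section Layered.
Context {R : realType} {I : choiceType}.
Variable C : layered R I.
Implicit Types (u v w z : I -> R) (p q m : int) (N M : nat).
Local Notation lay := (layer C).
Local Notation sh := (slide C).
Local Notation rho := (reach C).

Definition translate m u : I -> R := fun x => u (sh m x).
Definition glue p u u' : I -> R := fun x => if lay x < p then u x else u' x.
Definition cmin u u' : I -> R := fun x => Num.min (u x) (u' x).
Definition cmax u u' : I -> R := fun x => Num.max (u x) (u' x).

Definition block p N u : R := \sum_(k < N) energy C (p + k%:Z) u.

(** By [energy_ge0] these are exactly the minimisers of the layer energy among
the invariant allowed configurations, once the minimal value is 0. *)
Definition ground z := [/\ allowed C z, forall x, z (sh 1 x) = z x &
  energy C 0 z = 0].

Lemma translateD m k u : translate m (translate k u) = translate (k + m) u.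
Proof. by apply/funext => x; rewrite /translate slideD. Qed.

Lemma allowed_translate m u : allowed C u -> allowed C (translate m u).
Proof. exact: (allowed_reindex (fun=> m)). Qed.

Lemma invariant_slide z : (forall x, z (sh 1 x) = z x) ->
  forall m x, z (sh m x) = z x.
Proof.
move=> z1.
have zn (k : nat) x : z (sh k x) = z x.
  elim: k => [|k IH]; first by rewrite slide0.
  by rewrite -IH -[RHS]z1 slideD; congr (z (sh _ x)); lia.
move=> [k|k] x; first exact: zn.
by rewrite -(zn k.+1) slideD NegzE subrr slide0.
Qed.

Lemma translate_ground z m : ground z -> translate m z = z.
Proof. by case=> _ z1 _; apply/funext => x; apply: invariant_slide. Qed.

Lemma energy_ground z i : ground z -> energy C i z = 0.
Proof.
move=> zg; have [_ _ <-] := zg; rewrite -[in RHS](translate_ground i zg).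
by rewrite energy_slide add0r.
Qed.

Lemma block1 p u : block p 1 u = energy C p u.
Proof. by rewrite /block big_ord1 addr0. Qed.

Lemma blockD p N M u : block p (N + M) u = block p N u + block (p + N%:Z) M u.
Proof.
rewrite /block big_split_ord /=; congr (_ + _).
by apply: eq_bigr => k _; congr (energy C _ u); lia.
Qed.

Lemma block_slide p N m u : block p N (translate m u) = block (p + m) N u.
Proof.
by apply: eq_bigr => k _; rewrite energy_slide; congr (energy C _ u); lia.
Qed.

Lemma block_local p N u u' :
  (forall x, p - rho%:Z <= lay x < p + N%:Z + rho%:Z -> u x = u' x) ->
  block p N u = block p N u'.
Proof.
move=> uu'; apply: eq_bigr => k _; apply: energy_local => x xk; apply: uu'.
by have := ltn_ord k; lia.
Qed.

Lemma block_submodular p N u u' :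
  block p N (cmin u u') + block p N (cmax u u') <= block p N u + block p N u'.
Proof.
by rewrite -!big_split /=; apply: ler_sum => k _; apply: energy_submodular.
Qed.

Lemma block_ground p N z : ground z -> block p N z = 0.
Proof. by move=> zg; apply: big1 => k _; apply: energy_ground. Qed.

Lemma block_eq_ground p N u z : ground z ->
  (forall x, p - rho%:Z <= lay x < p + N%:Z + rho%:Z -> u x = z x) ->
  block p N u = 0.
Proof. by move=> zg uz; rewrite (block_local uz) block_ground. Qed.

(** The halving argument. The minimum and the maximum of [u] and of its
translate by half a period have half the period, and one half period of each
costs together at most one full period of [u]. Restricting to powers of two
avoids sorting more than two translates. *)
Lemma periodic_block_ge0 k p u : allowed C u ->
  translate (2 ^ k)%N u = u -> 0 <= block p (2 ^ k)%N u.
Proof.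
elim: k p u => [|k IH] p u Pu; rewrite ?expn0 => uT.
  rewrite block1 -[p]add0r -energy_slide.
  apply: energy_ge0; first exact: allowed_translate.
  move=> x; rewrite -{2}uT /translate !slideD; congr (u (sh _ x)); lia.
pose u' := translate (2 ^ k)%N u.
have u'T : translate (2 ^ k)%N u' = u.
  by rewrite /u' translateD -[RHS]uT; congr (translate _ u); rewrite expnS; lia.
have mT : translate (2 ^ k)%N (cmin u u') = cmin u u'.
  apply/funext => x; rewrite /translate /cmin minC.
  by rewrite -[u' (sh _ _)]/(translate (2 ^ k)%N u' x) u'T.
have MT : translate (2 ^ k)%N (cmax u u') = cmax u u'.
  apply/funext => x; rewrite /translate /cmax maxC.
  by rewrite -[u' (sh _ _)]/(translate (2 ^ k)%N u' x) u'T.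
have Pu' : allowed C u' by exact: allowed_translate.
have := IH p _ (allowed_min Pu Pu') mT; have := IH p _ (allowed_max Pu Pu') MT.
rewrite -!/(cmin _ _) -!/(cmax _ _) => h1 h2.
have := block_submodular p (2 ^ k) u u'.
rewrite {3}/u' block_slide -blockD addnn -mul2n -expnS.
by lra.
Qed.

(** Continue the window periodically, with a period so large that distinct
copies do not interact; [periodic_block_ge0] applies to the result. *)
Lemma excursion_ge0 p N u z : ground z -> allowed C u ->
  (forall x, lay x < p \/ p + N%:Z <= lay x -> u x = z x) ->
  0 <= block (p - rho%:Z) (N + 2 * rho) u.
Proof.
move=> zg Pu uz; have [_ z1 _] := zg.
pose k := (N + 4 * rho)%N; pose M := (2 ^ k)%N.
have MN : (N + 4 * rho < M)%N by exact: ltn_expl.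
pose p0 := p - (2 * rho)%:Z.
(* [y x] is the translate of [x] by a multiple of the period into the layers
   [p0, p0 + M) *)
pose f (l : int) : int := - (M%:Z * ((l - p0) %/ M%:Z)%Z).
pose y x := sh (f (lay x)) x.
have ly x : lay (y x) = p0 + ((lay x - p0) %% M%:Z)%Z.
  rewrite /y layer_slide /f /modz; lia.
have M0 : (M%:Z != 0) by lia.
have yT x : y (sh M x) = y x.
  rewrite /y slideD layer_slide; congr (sh _ x); rewrite /f.
  have -> : lay x + M%:Z - p0 = 1 * M%:Z + (lay x - p0) by lia.
  by rewrite divzMDl//; lia.
have uyT : translate (2 ^ k)%N (u \o y) = u \o y.
  by apply/funext => x; rewrite /translate /= -/M yT.
have Pw : allowed C (u \o y) by exact: (allowed_reindex f).
have := periodic_block_ge0 (p - rho%:Z) Pw uyT.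
have -> : (2 ^ k)%N = (N + 2 * rho + (M - N - 2 * rho))%N by rewrite -/M; lia.
have -> : block (p - rho%:Z) (N + 2 * rho + (M - N - 2 * rho)) (u \o y) =
    block (p - rho%:Z) (N + 2 * rho) u; last by [].
rewrite blockD [X in _ + X](@block_eq_ground _ _ (u \o y) z zg) ?addr0.
  apply: block_local => x xl /=; congr (u _).
  rewrite /y /f divz_small; first by rewrite mulr0 oppr0 slide0.
  rewrite /p0; lia.
move=> x xl /=.
have -> : z x = z (y x) by rewrite /y invariant_slide.
apply: uz; rewrite ly.
have := ltz_mod (lay x - p0) M0; have := modz_ge0 (lay x - p0) M0.
have := divz_eq (lay x - p0) M%:Z.
set Q := (_ %/ _)%Z; set r := (_ %% _)%Z; rewrite /p0 => *.
have [Q1|Q1] : Q <= 0 \/ Q >= 1 by lia.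
  right; nia.
by left; nia.
Qed.

(** The energy of [u] cut off to the ground state [z] below layer 0, minus the
energy of the layers of [u] from 0 on. Only layers near 0 contribute, so that
it is a continuous function of [u], and it vanishes at [u = z]. *)
Definition cut_left z u : R :=
  block (- rho%:Z) (2 * rho) (glue 0 z u) - block 0 rho u.
Definition cut_right z u : R :=
  block (- rho%:Z) (2 * rho) (glue 0 u z) - block (- rho%:Z) rho u.

Lemma cut_block p N z z' u : ground z -> ground z' -> (2 * rho <= N)%N ->
  block (p - rho%:Z) (N + 2 * rho) (glue p z (glue (p + N%:Z) u z')) =
  cut_left z (translate p u) + block p N u +
    cut_right z' (translate (p + N%:Z) u).
Proof.
move=> zg zg' rN; rewrite /cut_left /cut_right.
set g := glue p z _.
have -> : (N + 2 * rho = 2 * rho + (N - 2 * rho) + 2 * rho)%N by lia.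
have -> : block p N u = block p (rho + (N - 2 * rho) + rho) u.
  by congr (block p _ u); lia.
rewrite (blockD _ (2 * rho + _)) (blockD _ (2 * rho)).
rewrite (blockD _ (rho + _)) (blockD _ rho) !block_slide add0r.
have -> : block (p - rho%:Z) (2 * rho) g =
    block (- rho%:Z) (2 * rho) (glue 0 z (translate p u)).
  rewrite [p - _]addrC -block_slide; apply: block_local => x xl.
  rewrite /g /glue /translate layer_slide.
  have -> : (lay x + p < p) = (lay x < 0) by lia.
  case: ifP => xl0.
    by rewrite (invariant_slide (let: And3 _ h _ := zg in h)).
  by have -> : lay x + p < p + N%:Z by lia.
have -> : block (p - rho%:Z + (2 * rho + (N - 2 * rho))%N%:Z) (2 * rho) g =
    block (- rho%:Z) (2 * rho) (glue 0 (translate (p + N%:Z) u) z').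
  have -> : p - rho%:Z + (2 * rho + (N - 2 * rho))%N%:Z =
    - rho%:Z + (p + N%:Z) by lia.
  rewrite -block_slide; apply: block_local => x xl.
  rewrite /g /glue /translate layer_slide.
  have -> : (lay x + (p + N%:Z) < p) = false by lia.
  have -> : (lay x + (p + N%:Z) < p + N%:Z) = (lay x < 0) by lia.
  by case: ifP => // _; rewrite (invariant_slide (let: And3 _ h _ := zg' in h)).
have -> : block (p - rho%:Z + (2 * rho)%N%:Z) (N - 2 * rho) g =
    block (p + rho%:Z) (N - 2 * rho) u.
  have -> : p - rho%:Z + (2 * rho)%N%:Z = p + rho%:Z by lia.
  apply: block_local => x xl; rewrite /g /glue.
  have -> : (lay x < p) = false by lia.
  by have -> : lay x < p + N%:Z by lia.
have -> : p + (rho + (N - 2 * rho))%N%:Z = - rho%:Z + (p + N%:Z) by lia.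
by ring.
Qed.

(** The basic lower bound: the energy of a long enough block is at least minus
the cost of cutting off both its ends, which turns it into an excursion. *)
Lemma block_ge_cuts p N z u : ground z -> allowed C u -> (2 * rho <= N)%N ->
  0 <= cut_left z (translate p u) + block p N u +
    cut_right z (translate (p + N%:Z) u).
Proof.
move=> zg Pu rN; rewrite -cut_block//; have [Pz _ _] := zg.
apply: (@excursion_ge0 p N _ z) => //.
  by do 2!apply: allowed_glue => //.
move=> x xl; rewrite /glue; case: ifP => // xp.
by case: ifP => // xN; lia.
Qed.

Lemma cut_left_ground z : ground z -> cut_left z z = 0.
Proof.
move=> zg; rewrite /cut_left (_ : glue 0 z z = z) ?block_ground ?subrr//.
by apply/funext => x; rewrite /glue if_same.
Qed.

Lemma cut_right_ground z : ground z -> cut_right z z = 0.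
Proof.
move=> zg; rewrite /cut_right (_ : glue 0 z z = z) ?block_ground ?subrr//.
by apply/funext => x; rewrite /glue if_same.
Qed.

End Layered.

(** * The topology of pointwise convergence *)

Section PointwiseTopology.
Context {R : realType} {I : choiceType}.
Local Notation T := {ptws I -> R}.

Lemma cvg_pointwise (J : Type) (F : set_system J) (h : J -> I -> R)
    (u : I -> R) : Filter F ->
  (forall x, h j x @[j --> F] --> u x) -> (h : J -> T) @ F --> (u : T).
Proof.
move=> FF hu; apply/cvg_sup => x A [B [[D oD <-]] Du DA].
by apply: filterS DA _; apply: (hu x); apply: open_nbhs_nbhs; split.
Qed.

Lemma eval_continuous (x : I) : continuous (fun u : T => u x).
Proof. exact: (@proj_continuous I (fun=> R) x). Qed.

Lemma continuous_pointwise (X : topologicalType) (h : X -> T) :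
  (forall x, continuous (fun y => h y x)) -> continuous h.
Proof.
by move=> hx y; apply: (@cvg_pointwise X (nbhs y) h (h y)) => x; apply: hx.
Qed.

Lemma closed_le_continuous (X : topologicalType) (f g : X -> R) :
  continuous f -> continuous g -> closed [set x | f x <= g x].
Proof.
move=> cf cg.
rewrite (_ : [set x | f x <= g x] =
    (fun x => f x - g x) @^-1` [set y | y <= 0]).
  apply: preimage_closed; last exact: closed_le.
  by move=> x _; apply: continuousB; [apply: cf|apply: cg].
by apply/seteqP; split => x /=; rewrite subr_le0.
Qed.

Lemma closed_eq_continuous (X : topologicalType) (f g : X -> R) :
  continuous f -> continuous g -> closed [set x | f x = g x].
Proof.
move=> cf cg.
rewrite (_ : [set _ | _] = [set x | f x <= g x] `&` [set x | g x <= f x]).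
  by apply: closedI; apply: closed_le_continuous.
apply/seteqP; split => x /=; first by move=> ->.
by move=> [xy yx]; apply/eqP; rewrite eq_le xy yx.
Qed.

Lemma closed_forall (X : topologicalType) (J : Type) (P : J -> set X) :
  (forall j, closed (P j)) -> closed [set x | forall j, P j x].
Proof.
move=> cP; rewrite (_ : [set x | _] = \bigcap_(j in setT) P j).
  exact: closed_bigI.
by apply/seteqP; split => [x /= Px j _|x /= Px j]; apply: Px.
Qed.

Lemma cvg_sumr (X J : Type) (F : set_system X) (l : seq J) (f : J -> X -> R)
    (a : J -> R) : Filter F -> (forall j, f j x @[x --> F] --> a j) ->
  \sum_(j <- l) f j x @[x --> F] --> \sum_(j <- l) a j.
Proof.
move=> FF fa; elim: l => [|j l IH].
  by rewrite big_nil; under eq_cvg do rewrite big_nil; exact: cvg_cst.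
rewrite big_cons; under eq_cvg do rewrite big_cons.
by apply: cvgD.
Qed.

Lemma continuous_sumr (X : topologicalType) (J : Type) (l : seq J)
    (F : J -> X -> R) : (forall j, continuous (F j)) ->
  continuous (fun x => \sum_(j <- l) F j x).
Proof. by move=> cF x; apply: cvg_sumr => j; exact: cF. Qed.

Lemma closure_sub (X : topologicalType) (A B : set X) x : closed B ->
  A `<=` B -> closure A x -> B x.
Proof. by move=> cB AB /(closure_subset AB)/cB. Qed.

Lemma cvg_int_shift (g : int -> R) (l : R) (m : int) :
  g k%:Z @[k --> \oo] --> l -> g (k%:Z + m) @[k --> \oo] --> l.
Proof.
move=> /cvgrPdist_le gl; apply/cvgrPdist_le => e e0.
have [K _ KP] := gl e e0.
exists (K + absz m)%N => // k /= Kk.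
have -> : k%:Z + m = (absz (k%:Z + m)%R)%:Z by lia.
by apply: KP => /=; lia.
Qed.

End PointwiseTopology.

(** * Minimisers with prescribed ends *)

(** Two ground states with no other invariant ground state between them.
[cells] lists one site of each class of layer 0, so that an allowed
configuration is determined by countably many values, finitely many in each
layer; this provides strictly monotone continuous functionals. *)
Record gap (R : realType) (I : choiceType) (C : layered R I) := Gap {
  lower : I -> R;
  upper : I -> R;
  lower_ground : ground C lower;
  upper_ground : ground C upper;
  lower_le_upper : forall x, lower x <= upper x;
  base : I;
  lower_lt_upper : lower base < upper base;
  energy_continuous : forall i, continuous (energy C i : {ptws I -> R} -> R);
  allowed_closed : closed (allowed C : set {ptws I -> R});
  cells : seq I;
  cells_layer : forall x, x \in cells -> layer C x = 0;
  cells_determine : forall u u', allowed C u -> allowed C u' ->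
    (forall m x, x \in cells -> u (slide C m x) = u' (slide C m x)) -> u = u';
  gap_empty : forall u, allowed C u ->
    (forall x, lower x <= u x <= upper x) ->
    (forall x, u (slide C 1 x) = u x) -> energy C 0 u = 0 ->
    u = lower \/ u = upper }.

Section Connections.
Context {R : realType} {I : choiceType} {C : layered R I}.
Variable G : gap C.
Local Notation T := {ptws I -> R}.
Implicit Types (u : I -> R) (p q m : int) (N M : nat).
Local Notation lay := (layer C).
Local Notation sh := (slide C).
Local Notation rho := (reach C).
Local Notation v := (lower G).
Local Notation w := (upper G).
Local Notation o := (base G).
Local Notation tr := (translate C).
Local Notation S := (block C).

Let vg : ground C v := lower_ground G.
Let wg : ground C w := upper_ground G.

Definition band u := allowed C u /\ forall x, v x <= u x <= w x.

(** Comparison configurations for the minimisation: their end layers have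
energy 0, so that the total energy is a finite sum, and for each window they
form a compact set. *)
Definition transition p N u := [/\ band u,
  forall x, lay x < p -> u x = v x &
  forall x, p + N%:Z <= lay x -> u x = w x].

Definition transition_cost p N u : R := S (p - rho%:Z) (N + 2 * rho) u.

(** An infimum over transitions only; by cutting off the ends of a connection
it is also the infimum over all connections. *)
Definition least_cost : R :=
  inf [set c | exists p N u, transition p N u /\ c = transition_cost p N u].

Definition partial_sum u (x : nat * nat) : R :=
  S (- x.1%:Z) (x.1 + x.2).+1 u.

Definition connection u := [/\ band u,
  forall x, u (sh (- k%:Z) x) @[k --> \oo] --> v x &
  forall x, u (sh k%:Z x) @[k --> \oo] --> w x].

(** Convergence of the partial sums in place of their lower limit: the two agree
because the sums almost increase, and convergence can be used along any
sequence of windows. *)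
Definition minimal u := connection u /\
  partial_sum u x @[x --> filter_prod \oo \oo] --> least_cost.

Lemma lower_slide m x : v (sh m x) = v x.
Proof. by apply: invariant_slide; case: vg. Qed.

Lemma upper_slide m x : w (sh m x) = w x.
Proof. by apply: invariant_slide; case: wg. Qed.

Lemma band_lower : band v.
Proof.
by split; [case: vg|move=> x; rewrite lexx lower_le_upper].
Qed.

Lemma band_upper : band w.
Proof.
by split; [case: wg|move=> x; rewrite lexx lower_le_upper].
Qed.

Lemma band_translate m u : band u -> band (tr m u).
Proof.
move=> [Pu vuw]; split; first exact: allowed_translate.
by move=> x; rewrite /translate -(lower_slide m) -(upper_slide m).
Qed.

Lemma band_min u u' : band u -> band u' -> band (cmin u u').
Proof.
move=> [Pu uvw] [Pu' uvw']; split; first exact: allowed_min.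
move=> x; rewrite /cmin le_min ge_min.
by have /andP[-> ->] := uvw x; have /andP[-> _] := uvw' x.
Qed.

Lemma band_max u u' : band u -> band u' -> band (cmax u u').
Proof.
move=> [Pu uvw] [Pu' uvw']; split; first exact: allowed_max.
move=> x; rewrite /cmax ge_max le_max.
by have /andP[-> ->] := uvw x; have /andP[_ ->] := uvw' x.
Qed.

Lemma band_glue p u u' : band u -> band u' -> band (glue C p u u').
Proof.
move=> [Pu uvw] [Pu' uvw']; split; first exact: allowed_glue.
by move=> x; rewrite /glue; case: ifP.
Qed.

Lemma band_closed : closed (band : set T).
Proof.
have cl : closed ([set u : T | forall x, v x <= u x] `&`
    [set u : T | forall x, u x <= w x]).
  apply: closedI; apply: closed_forall => x; apply: closed_le_continuous;
    by [exact: cst_continuous|exact: eval_continuous].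
rewrite (_ : band = allowed C `&` ([set u : T | forall x, v x <= u x] `&`
    [set u : T | forall x, u x <= w x])).
  by apply: closedI => //; exact: allowed_closed G.
apply/seteqP; split => u [Pu].
  by move=> h; split=> //; split=> x; have /andP[] := h x.
by move=> [h1 h2]; split => // x; rewrite h1 h2.
Qed.

Lemma band_compact : compact (band : set T).
Proof.
have cbox : compact [set u : T | forall x, `[v x, w x]%classic (u x)].
  apply: (@tychonoff I (fun=> R) (fun x => `[v x, w x]%classic)) => x.
  exact: segment_compact.
apply: subclosed_compact cbox _; first exact: band_closed.
by move=> u [_ h] x /=; rewrite in_itv /=.
Qed.

Lemma band_bounded (F : T -> R) : continuous F ->
  exists2 b, 0 <= b & forall u, band u -> `|F u| <= b.
Proof.
move=> cF; have cK : compact (F @` (band : set T)).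
  by apply: continuous_compact band_compact; exact: continuous_subspaceT.
have [M [_ Mb]] := compact_bounded cK.
exists (Num.max 0 M + 1); first by rewrite addr_ge0// le_max lexx.
move=> u bu; apply: Mb; last by exists u.
by rewrite ltr_pwDr// le_max lexx orbT.
Qed.

Lemma translate_continuous m : continuous (tr m : T -> T).
Proof.
apply: (@continuous_pointwise R I T) => x.
exact: (@eval_continuous R I (sh m x)).
Qed.

Lemma glue_right_continuous p z : continuous (glue C p z : T -> T).
Proof.
apply: (@continuous_pointwise R I T) => x; rewrite /glue; case: (lay x < p).
  exact: cst_continuous.
exact: eval_continuous.
Qed.

Lemma glue_left_continuous p z : continuous ((fun u => glue C p u z) : T -> T).
Proof.
apply: (@continuous_pointwise R I T) => x; rewrite /glue; case: (lay x < p).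
  exact: eval_continuous.
exact: cst_continuous.
Qed.

Lemma block_continuous p N : continuous (S p N : T -> R).
Proof.
by apply: (@continuous_sumr R T) => k; exact: (energy_continuous G).
Qed.

Lemma cut_left_continuous z : continuous (cut_left C z : T -> R).
Proof.
move=> u; rewrite /cut_left; apply: continuousB; last exact: block_continuous.
apply: (@continuous_comp T T R); first exact: glue_right_continuous.
exact: block_continuous.
Qed.

Lemma cut_right_continuous z : continuous (cut_right C z : T -> R).
Proof.
move=> u; rewrite /cut_right; apply: continuousB; last exact: block_continuous.
apply: (@continuous_comp T T R); first exact: glue_left_continuous.
exact: block_continuous.
Qed.

Lemma cut_left_eq0 z u : ground C z ->
  (forall x, lay x < (2 * rho)%:Z -> u x = z x) -> cut_left C z u = 0.
Proof.
move=> zg uz; rewrite /cut_left !(block_eq_ground zg) ?subrr// => x xl.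
  by apply: uz; lia.
by rewrite /glue; case: ifP => // _; apply: uz; lia.
Qed.

Lemma cut_right_eq0 z u : ground C z ->
  (forall x, - (2 * rho)%:Z <= lay x -> u x = z x) -> cut_right C z u = 0.
Proof.
move=> zg uz; rewrite /cut_right !(block_eq_ground zg) ?subrr// => x xl.
  by apply: uz; lia.
by rewrite /glue; case: ifP => // _; apply: uz; lia.
Qed.

Lemma transition_translate m p N u :
  transition p N u -> transition (p - m) N (tr m u).
Proof.
move=> [bu uv uw]; split; first exact: band_translate.
  by move=> x xp; rewrite /translate uv ?lower_slide// layer_slide; lia.
by move=> x xp; rewrite /translate uw ?upper_slide// layer_slide; lia.
Qed.

Lemma transition_cost_translate m p N u :
  transition_cost (p - m) N (tr m u) = transition_cost p N u.
Proof.
by rewrite /transition_cost block_slide; congr (S _ _ u); lia.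
Qed.

(** Enlarging the window of summation only adds layers of ground state
energy 0. *)
Lemma transition_block p N u P M : transition p N u ->
  P <= p - rho%:Z -> p + N%:Z + rho%:Z <= P + M%:Z ->
  S P M u = transition_cost p N u.
Proof.
move=> [_ uv uw] Pp pM; rewrite /transition_cost.
pose A := absz (p - rho%:Z - P)%R.
pose B := absz (P + M%:Z - (p + N%:Z + rho%:Z))%R.
have -> : M = (A + (N + 2 * rho) + B)%N by rewrite /A /B; lia.
rewrite blockD (blockD _ _ A).
rewrite [X in X + _ + _](@block_eq_ground _ _ _ _ _ _ _ vg); last first.
  by move=> x xl; apply: uv; rewrite /A in xl; lia.
rewrite [X in _ + X](@block_eq_ground _ _ _ _ _ _ _ wg); last first.
  by move=> x xl; apply: uw; rewrite /A in xl; lia.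
by rewrite add0r addr0; congr (S _ _ u); rewrite /A; lia.
Qed.

Lemma transition_cost_ge : exists c, forall p N u, transition p N u ->
  c <= transition_cost p N u.
Proof.
have [b b0 bP] := band_bounded (@cut_left_continuous v).
have [b' b0' bP'] := band_bounded (@cut_right_continuous v).
exists (- (b + b')) => p N u [bu _ _].
have [Pu _] := bu.
have := @block_ge_cuts _ _ C (p - rho%:Z) (N + 2 * rho) v u vg Pu.
have le : (2 * rho <= N + 2 * rho)%N by lia.
move=> /(_ le) h.
have := bP _ (band_translate (p - rho%:Z) bu).
have := bP' _ (band_translate (p - rho%:Z + (N + 2 * rho)%:Z) bu).
rewrite !ler_norml /transition_cost => /andP[_ h1] /andP[_ h2].
lra.
Qed.

Lemma transition_step : transition 0 0 (glue C 0 v w).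
Proof.
split; first by apply: band_glue; [exact: band_lower|exact: band_upper].
  by move=> x x0; rewrite /glue x0.
by move=> x x0; rewrite /glue; case: ifP => //; lia.
Qed.

Lemma least_cost_le p N u : transition p N u ->
  least_cost <= transition_cost p N u.
Proof.
move=> tu; apply: ge_inf; last by exists p, N, u.
have [c cP] := transition_cost_ge.
by exists c => _ [p' [N' [u' [tu' ->]]]]; exact: cP tu'.
Qed.

Lemma least_cost_adherent (e : R) : 0 < e -> exists p N u,
  transition p N u /\ transition_cost p N u < least_cost + e.
Proof.
move=> e0; set A := [set c | exists p N u,
  transition p N u /\ c = transition_cost p N u].
have infA : has_inf A.
  split; first by exists (transition_cost 0 0 (glue C 0 v w)), 0, 0%N,
    (glue C 0 v w); split => //; exact: transition_step.
  have [c cP] := transition_cost_ge.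
  by exists c => _ [p' [N' [u' [tu' ->]]]]; exact: cP tu'.
have [_ [p [N [u [tu ->]]]] lt] := inf_adherent e0 infA.
by exists p, N, u.
Qed.

Lemma transition_closed p N : closed (transition p N : set T).
Proof.
rewrite (_ : transition p N = (band : set T) `&` 
   ([set u : T | forall x : {x | lay x < p}, u (val x) = v (val x)] `&`
    [set u : T | forall x : {x | p + N%:Z <= lay x}, u (val x) = w (val x)])).
  apply: closedI; first exact: band_closed.
  by apply: closedI; apply: closed_forall => x; apply: closed_eq_continuous;
    by [exact: cst_continuous|exact: eval_continuous].
apply/seteqP; split => u.
  by move=> [bu uv uw]; split => //; split => -[x xl] /=; [apply: uv|apply: uw].
move=> [bu [uv uw]]; split => // x xl; first exact: (uv (exist _ x xl)).
exact: (uw (exist _ x xl)).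
Qed.

(** Among the minimisers for the given window, take one for which the sum [L]
of the values over the window is smallest. Its minimum with its translate [u']
is again admissible, and their maximum is admissible after translation by -1;
by submodularity the minimum is a minimiser too, so it cannot be smaller than
[u], whence [u <= u']. *)
Lemma monotone_minimizer p N u0 : transition p N u0 -> exists u,
  [/\ transition p N u, transition_cost p N u <= transition_cost p N u0 &
      forall x, u x <= u (sh 1 x)].
Proof.
move=> tu0; pose W : set T := transition p N.
have cW : compact W.
  apply: subclosed_compact band_compact _; first exact: transition_closed.
  by move=> u [].
have cE : continuous (transition_cost p N : T -> R) by exact: block_continuous.
have [|u1 u1W u1min] := @compact_EVT_min T R _ W _ cW (continuous_subspaceT cE).
  by exists u0.
pose A : set T := W `&`
  [set u | transition_cost p N u <= transition_cost p N u1].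
have cA : compact A.
  apply: compact_closedI => //; apply: closed_le_continuous => //.
  exact: cst_continuous.
pose L (u : T) := \sum_(k < N) \sum_(x <- cells G) u (sh (p + k%:Z) x).
have cL : continuous L.
  apply: (@continuous_sumr R T) => k; apply: (@continuous_sumr R T) => x.
  exact: eval_continuous.
have [|u uA umin] := @compact_EVT_min T R _ A _ cA (continuous_subspaceT cL).
  by exists u1; split; [exact: set_mem|rewrite /= lexx].
have [tu uu1] := set_mem uA; have [bu uv uw] := tu.
exists u; split => //.
  by apply: le_trans uu1 _; apply: u1min; exact: mem_set.
pose u' := tr 1 u.
have bu' : band u' by exact: band_translate.
have tmin : transition p N (cmin u u').
  split; first exact: band_min.
    move=> x xp; rewrite /cmin uv//; apply/min_idPl.
    by have /andP[] := proj2 bu' x.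
  move=> x xp; rewrite /cmin uw// /u' /translate uw ?upper_slide ?minxx//.
  by rewrite layer_slide; lia.
(* [u'] jumps one layer earlier than [u], hence the translation by -1 *)
have tmax : transition p N (tr (-1) (cmax u u')).
  split; first by apply: band_translate; exact: band_max.
    move=> x xp; rewrite /cmax /translate uv; last by rewrite layer_slide; lia.
    rewrite /u' /translate slideD uv; last by rewrite layer_slide; lia.
    by rewrite !lower_slide maxxx.
  move=> x xp; rewrite /cmax /translate.
  rewrite [u' _]uw ?upper_slide; last by rewrite !layer_slide; lia.
  by apply/max_idPr; rewrite -(upper_slide (-1));
    have /andP[] := proj2 bu (sh (-1) x).
have h := block_submodular C (p - rho%:Z - 1) (N + 2 * rho).+1 u u'.
have tu' := transition_translate 1 tu.
have E1 : S (p - rho%:Z - 1) (N + 2 * rho).+1 (cmin u u') =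
    transition_cost p N (cmin u u') by apply: transition_block => //; lia.
have E2 : S (p - rho%:Z - 1) (N + 2 * rho).+1 (cmax u u') =
    transition_cost p N (tr (-1) (cmax u u')).
  rewrite -(@transition_block _ _ _ (p - rho%:Z) (N + 2 * rho).+1 tmax);
    try lia.
  by rewrite block_slide.
have E3 : S (p - rho%:Z - 1) (N + 2 * rho).+1 u = transition_cost p N u.
  by apply: transition_block => //; lia.
have E4 : S (p - rho%:Z - 1) (N + 2 * rho).+1 u' = transition_cost p N u.
  rewrite -(transition_cost_translate 1).
  by apply: transition_block => //; lia.
rewrite {}E1 {}E2 {}E3 {}E4 in h.
have h1 : transition_cost p N u1 <= transition_cost p N (cmin u u').
  by apply: u1min; exact: mem_set.
have h2 : transition_cost p N u1 <= transition_cost p N (tr (-1) (cmax u u')).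
  by apply: u1min; exact: mem_set.
rewrite /= in uu1.
have Lmin : L u <= L (cmin u u').
  by apply: umin; apply: mem_set; split => //=; lra.
have lemin x : cmin u u' x <= u x by rewrite /cmin ge_min lexx.
have eqc (k : 'I_N) x : x \in cells G ->
    cmin u u' (sh (p + k%:Z) x) = u (sh (p + k%:Z) x).
  move=> xc; apply/eqP; rewrite eq_le lemin /= -subr_le0.
  have : \sum_(k < N) \sum_(x <- cells G)
     (u (sh (p + k%:Z) x) - cmin u u' (sh (p + k%:Z) x)) <= 0.
    under eq_bigr do rewrite sumrB.
    by rewrite sumrB subr_le0.
  apply: le_trans; rewrite (bigD1 k)//= (big_rem x)//= -addrA lerDl.
  rewrite addr_ge0//; last apply: sumr_ge0 => ? _;
    by apply: sumr_ge0 => ? _; rewrite subr_ge0.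
have ue : u = cmin u u' :> (I -> R).
  have [Pu _] := bu; have [Pu' _] := band_min bu bu'.
  apply: (cells_determine Pu Pu') => m x xc.
  have lx : lay (sh m x) = m.
    by rewrite layer_slide; have := @cells_layer _ _ _ G x xc; lia.
  have [mp|pm] := ltP m p.
    by case: tmin => _ hv _; rewrite uv ?hv ?lx.
  have [mN|Nm] := ltP m (p + N%:Z); last first.
    by case: tmin => _ _ hw; rewrite uw ?hw ?lx.
  have kN : (absz (m - p)%R < N)%N by lia.
  have := eqc (Ordinal kN) x xc; rewrite /=.
  by have -> : p + `|m - p|%N%:Z = m by lia.
by move=> x; rewrite {1}ue /cmin ge_min /u' /translate lexx orbT.
Qed.

End Connections.

(** * Minimal connections between two ground states *)

Section Minimal.
Context {R : realType} {I : choiceType} {C : layered R I}.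
Variable G : gap C.
Local Notation T := {ptws I -> R}.
Implicit Types (u : I -> R) (p q m : int) (N M : nat).
Local Notation lay := (layer C).
Local Notation sh := (slide C).
Local Notation rho := (reach C).
Local Notation v := (lower G).
Local Notation w := (upper G).
Local Notation o := (base G).
Local Notation tr := (translate C).
Local Notation S := (block C).
Local Notation c := (least_cost G).
Local Notation cost := (@transition_cost R I C).
Local Notation psum := (@partial_sum R I C).

Let vg : ground C v := lower_ground G.
Let wg : ground C w := upper_ground G.
Let v_inv m x : v (sh m x) = v x := lower_slide G m x.
Let w_inv m x : w (sh m x) = w x := upper_slide G m x.

Let mid : R := (v o + w o) / 2.

Let v_mid : v o < mid.
Proof. by have := lower_lt_upper G; rewrite /mid; lra. Qed.

Let mid_w : mid < w o.
Proof. by have := lower_lt_upper G; rewrite /mid; lra. Qed.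

(** Translations act on transitions, so a crossing of the middle of the gap is
pinned at the base site; otherwise minimising sequences could converge to one
of the two ground states. *)
Definition near_optimal (e : R) : set T := [set u | exists p N,
  [/\ transition G p N u, cost p N u <= c + e,
      forall x, u x <= u (sh 1 x), u o <= mid & mid <= u (sh 1 o)]].

Lemma near_optimal_nonempty e : 0 < e -> near_optimal e !=set0.
Proof.
move=> e0; have [p [N [u0 [tu0 ltu0]]]] := least_cost_adherent G e0.
have [u [tu uu0 umono]] := monotone_minimizer tu0.
have [bu uv uw] := tu.
pose g (k : nat) := u (sh (p - 1 - lay o + k%:Z) o).
have g0 : g 0%N = v o.
  by rewrite /g uv ?v_inv// layer_slide; lia.
have exk : exists k, mid < g k.
  exists (N.+1); rewrite /g uw ?w_inv// layer_slide; lia.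
have [k gk kmin] := ex_minnP exk.
have k0 : (0 < k)%N.
  by rewrite lt0n; apply: contraTN gk => /eqP ->; rewrite g0 -leNgt ltW.
pose m := p - 1 - lay o + k.-1%:Z.
exists (tr m u), (p - m), N; split.
- exact: transition_translate.
- rewrite transition_cost_translate; apply: le_trans uu0 _; exact: ltW.
- move=> x; rewrite /translate slideD (addrC m 1) -(slideD C 1 m).
  exact: umono.
- rewrite leNgt; apply/negP => gk'; have := kmin k.-1 gk'; lia.
- rewrite /translate slideD.
  suff -> : m + 1 = p - 1 - lay o + k%:Z by exact: ltW.
  rewrite /m; lia.
Qed.

(** Below and above the block, [u] is an excursion from a ground state up to a
cut, so it has energy at least minus the cost of the cut. The bound involves
only continuous functions of [u] and survives in the limit. *)
Lemma near_optimal_block e p N u : near_optimal e u ->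
  S p N u <= c + e + cut_right C v (tr p u) + cut_left C w (tr (p + N%:Z) u).
Proof.
move=> [p' [M [tu cu _ _ _]]]; have [bu uv uw] := tu.
have [Pu _] := bu.
pose A := (`|p|%N + `|p'|%N + 4 * rho)%N.
pose B := (`|p|%N + `|p'|%N + N + M + 4 * rho)%N.
have := @transition_block _ _ _ _ _ _ _ (p - A%:Z) (A + N + B) tu.
move=> /(_ ltac:(rewrite /A; lia) ltac:(rewrite /A /B; lia)).
rewrite (blockD _ _ (A + N)) (blockD _ _ A) => e1.
have Al : (2 * rho <= A)%N by rewrite /A; lia.
have Bl : (2 * rho <= B)%N by rewrite /B; lia.
have := @block_ge_cuts _ _ C (p - A%:Z) A v u vg Pu Al.
rewrite cut_left_eq0//; last first.
  move=> x xl; rewrite /translate uv ?v_inv// layer_slide /A; lia.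
rewrite add0r subrK => h1.
have := @block_ge_cuts _ _ C (p - A%:Z + (A + N)%N%:Z) B w u wg Pu Bl.
rewrite [X in _ + _ + X]cut_right_eq0//; last first.
  move=> x xl; rewrite /translate uw ?w_inv// layer_slide /A /B; lia.
have -> : p - A%:Z + (A + N)%N%:Z = p + N%:Z by lia.
rewrite addr0 => h2.
move: e1; rewrite (_ : p - A%:Z + (A + N)%N%:Z = p + N%:Z); last by lia.
by rewrite subrK; lra.
Qed.

Lemma near_optimal_cluster : exists U : T, forall e, 0 < e ->
  closure (near_optimal e) U.
Proof.
pose F := filter_from [set e : R | 0 < e] near_optimal.
have FF : Filter F.
  apply: filter_from_filter; first by exists 1; rewrite /= ltr01.
  move=> e e' /= e0 e0'; exists (Num.min e e'); first by rewrite /= lt_min e0.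
  by move=> u [p [N [tu cu mu a b]]]; split; exists p, N; split => //;
    apply: le_trans cu _; rewrite lerD2l ge_min lexx ?orbT.
have PF : ProperFilter F.
  by apply: filter_from_proper => e; exact: near_optimal_nonempty.
have [|U [_ clU]] := @band_compact _ _ _ G F PF.
  exists 1; first by rewrite /= ltr01.
  by move=> u [p [N [[]]]].
exists U => e e0 A /(clU _ _); apply; exists e => //.
Qed.

(** The energies of the layers of [U] tend to the energy of the limit [Z]; if
it were positive, blocks would have unbounded energy. A general sequence [t] of
layers treats both ends at once. *)
Lemma eventual_energy_eq0 U Z (t : nat -> int) b : allowed C Z ->
  (forall x, Z (sh 1 x) = Z x) ->
  (forall x, U (sh (t k) x) @[k --> \oo] --> Z x) ->
  (forall k N, \sum_(j < N) energy C (t (k + j)%N) U <= b) ->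
  energy C 0 Z = 0.
Proof.
move=> PZ Zinv UZ Ub.
have cv : energy C (t k) U @[k --> \oo] --> energy C 0 Z.
  under eq_cvg do rewrite -[t _]add0r -energy_slide.
  apply: (@cvg_comp nat T R (fun k => tr (t k) U) (energy C 0)) => /=.
    by apply: cvg_pointwise; exact: UZ.
  exact: (energy_continuous G).
apply/eqP; rewrite eq_le energy_ge0// andbT leNgt; apply/negP => e0.
have [K _ KP] := cvgr_ge _ cv (energy C 0 Z / 2) ltac:(lra).
pose N := (Num.truncn (b / (energy C 0 Z / 2))).+1.
have := Ub K N; apply/negP; rewrite -ltNge.
apply: (@lt_le_trans _ _ (\sum_(j < N) (energy C 0 Z / 2))); last first.
  by apply: ler_sum => j _; apply: KP => /=; rewrite leq_addr.
rewrite sumr_const card_ord -(mulr_natl (energy C 0 Z / 2) N) -ltr_pdivrMr;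
  last by lra.
by rewrite /N truncnS_gt.
Qed.

Lemma cut_cvg_lower U : connection G U ->
  cut_left C v (tr (- k%:Z) U) @[k --> \oo] --> 0 /\
  cut_right C v (tr (- k%:Z) U) @[k --> \oo] --> 0.
Proof.
move=> [_ Uv _]; rewrite -{1}(cut_left_ground vg) -(cut_right_ground vg).
by split;
  apply: (@cvg_comp nat T R (fun k => tr (- k%:Z) U) _ _ (nbhs (v : T)));
  [exact: cvg_pointwise|exact: cut_left_continuous|
   exact: cvg_pointwise|exact: cut_right_continuous].
Qed.

Lemma cut_cvg_upper U : connection G U ->
  cut_left C w (tr k%:Z U) @[k --> \oo] --> 0 /\
  cut_right C w (tr k%:Z U) @[k --> \oo] --> 0.
Proof.
move=> [_ _ Uw]; rewrite -{1}(cut_left_ground wg) -(cut_right_ground wg).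
by split; apply: (@cvg_comp nat T R (fun k => tr k%:Z U) _ _ (nbhs (w : T)));
  [exact: cvg_pointwise|exact: cut_left_continuous|
   exact: cvg_pointwise|exact: cut_right_continuous].
Qed.

(** Cut off both ends of [U]: the result is a transition. *)
Lemma partial_sum_ge U (x : nat * nat) : band G U ->
  (2 * rho <= (x.1 + x.2).+1)%N ->
  c <= cut_left C v (tr (- x.1%:Z) U) + psum U x +
       cut_right C w (tr x.2.+1%:Z U).
Proof.
move=> bU le.
have := @cut_block _ _ C (- x.1%:Z) (x.1 + x.2).+1 v w U vg wg le.
have -> : - x.1%:Z + (x.1 + x.2).+1%:Z = x.2.+1%:Z by lia.
move=> <-; apply: least_cost_le; split.
- apply: band_glue; first exact: band_lower.
  by apply: band_glue => //; exact: band_upper.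
- by move=> y yl; rewrite /glue yl.
- move=> y yl; rewrite /glue; do 2?case: ifP => //; lia.
Qed.

Local Notation P := (filter_prod (\oo : set_system nat) (\oo : set_system nat)).

Lemma cvg_prod_err (f g : nat -> R) : f k @[k --> \oo] --> 0 ->
  g k @[k --> \oo] --> 0 -> f x.1 + g x.2.+1 @[x --> P] --> 0.
Proof.
move=> f0 g0; rewrite -[X in _ --> X]addr0; apply: cvgD.
  by apply: (cvg_comp _ f) f0; exact: cvg_fst.
apply: (cvg_comp _ (fun k => g k.+1)); first exact: cvg_snd.
by rewrite (cvg_shiftS g).
Qed.

Local Notation near_pair K :=
  (fun x : nat * nat => (K <= x.1)%N /\ (K <= x.2)%N).

Lemma near_pair_near K : \forall x \near P, near_pair K x.
Proof.
exists ([set k | (K <= k)%N], [set k | (K <= k)%N]) => /=.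
  by split; exists K.
by move=> [a b] [].
Qed.

Lemma near_pairP (Q : set (nat * nat)) : (\forall x \near P, Q x) ->
  exists K, forall x, near_pair K x -> Q x.
Proof.
move=> [[A B] /= [[a _ aA] [b _ bB]] AB].
exists (maxn a b) => -[x y] /= [xa yb].
by apply: (AB (x, y)); split; [apply: aA|apply: bB] => /=; lia.
Qed.

Lemma partial_sum_ge_near U e : connection G U -> 0 < e ->
  \forall x \near P, c - e <= psum U x.
Proof.
move=> cU e0; have [bU _ _] := cU.
have [hl _] := cut_cvg_lower cU; have [_ hr] := cut_cvg_upper cU.
have := cvg_prod_err hl hr => /(cvgr_le _)/(_ e e0) h.
have := near_pair_near rho.
apply: filterS2 h => x /= h [x1 x2].
have := @partial_sum_ge U x bU ltac:(lia); lra.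
Qed.

(** The partial sums along a connection almost increase: the added layers are,
up to two cuts near a ground state, an excursion. This makes the lower limit
defining the total energy a limit. *)
Lemma partial_sum_mono U x x' : band G U ->
  (x.1 + 2 * rho <= x'.1)%N -> (x.2 + 2 * rho <= x'.2)%N ->
  psum U x <= psum U x' +
    (cut_left C v (tr (- x'.1%:Z) U) + cut_right C w (tr x'.2.+1%:Z U)) +
    (cut_right C v (tr (- x.1%:Z) U) + cut_left C w (tr x.2.+1%:Z U)).
Proof.
move=> [PU _] h1 h2; rewrite /partial_sum.
pose A := (x'.1 - x.1)%N; pose B := (x'.2 - x.2)%N.
have Al : (2 * rho <= A)%N by rewrite /A; lia.
have Bl : (2 * rho <= B)%N by rewrite /B; lia.
have -> : (x'.1 + x'.2).+1 = (A + (x.1 + x.2).+1 + B)%N by rewrite /A /B; lia.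
rewrite (blockD _ _ (A + _)) (blockD _ _ A).
have -> : - x'.1%:Z + A%:Z = - x.1%:Z by rewrite /A; lia.
have -> : - x'.1%:Z + (A + (x.1 + x.2).+1)%N%:Z = x.2.+1%:Z by rewrite /A; lia.
have := @block_ge_cuts _ _ C (- x'.1%:Z) A v U vg PU Al.
have -> : - x'.1%:Z + A%:Z = - x.1%:Z by rewrite /A; lia.
have := @block_ge_cuts _ _ C (x.2.+1%:Z) B w U wg PU Bl.
have -> : x.2.+1%:Z + B%:Z = x'.2.+1%:Z by rewrite /B; lia.
lra.
Qed.

Lemma minimal_of_frequently U : connection G U ->
  (forall e K, 0 < e -> exists2 x, near_pair K x & psum U x <= c + e) ->
  minimal G U.
Proof.
move=> cU freq; split => //; apply/cvgrPdist_le => e e0.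
have e3 : 0 < e / 3 by lra.
have [hl hl'] := cut_cvg_lower cU; have [hr' hr] := cut_cvg_upper cU.
have := cvg_prod_err hl hr => /(cvgr_le _)/(_ _ e3)/near_pairP[K1 K1P].
have := cvg_prod_err hl' hr' => /(cvgr_le _)/(_ _ e3)/near_pairP[K2 K2P].
have := partial_sum_ge_near cU e0; have := near_pair_near (K1 + K2).
apply: filterS2 => x [x1 x2] lowx.
have [x' [x1' x2'] ux'] := freq (e / 3) (K1 + K2 + x.1 + x.2 + 2 * rho)%N e3.
have [bU _ _] := cU.
have := @partial_sum_mono U x x' bU ltac:(lia) ltac:(lia).
have := K1P x' ltac:(split; lia); have := K2P x ltac:(split; lia).
rewrite ler_norml /= => *; apply/andP; split; lra.
Qed.

(** A cluster point of near optimal monotone transitions. Its limits at both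
ends exist by monotonicity, have energy 0 by [eventual_energy_eq0], and are
told apart by the crossing at the base site. *)
Lemma minimal_exists : exists U, minimal G U.
Proof.
have [U clU] := near_optimal_cluster.
have clB (B : set T) : closed B -> near_optimal 1 `<=` B -> B U.
  by move=> cB /(closure_sub cB); apply; exact: clU.
have bU : band G U by apply: clB; [exact: band_closed|move=> u [p [N [[]]]]].
have mU x : U x <= U (sh 1 x).
  apply: (clB [set u : T | u x <= u (sh 1 x)]).
    by apply: closed_le_continuous; exact: eval_continuous.
  by move=> u [p [N [_ _ mu _ _]]]; exact: mu.
have Uo : U o <= mid.
  apply: (clB [set u : T | u o <= mid]).
    apply: closed_le_continuous; first exact: eval_continuous.
    exact: cst_continuous.
  by move=> u [p [N [_ _ _ uo _]]].
have Uo1 : mid <= U (sh 1 o).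
  apply: (clB [set u : T | mid <= u (sh 1 o)]).
    apply: closed_le_continuous; first exact: cst_continuous.
    exact: eval_continuous.
  by move=> u [p [N [_ _ _ _ uo]]].
have UB p N : S p N U <=
    c + cut_right C v (tr p U) + cut_left C w (tr (p + N%:Z) U).
  apply/ler_addgt0Pr => e e0.
  apply: (@closure_sub T (near_optimal e) [set u : T | S p N u <=
      c + cut_right C v (tr p u) + cut_left C w (tr (p + N%:Z) u) + e]);
    last exact: clU.
    apply: closed_le_continuous; first exact: block_continuous.
    move=> u; apply: (@continuousD _ R T); last exact: cst_continuous.
    apply: (@continuousD _ R T).
      apply: (@continuousD _ R T); first exact: cst_continuous.
      apply: (@continuous_comp T T R); first exact: translate_continuous.
      exact: cut_right_continuous.
    apply: (@continuous_comp T T R); first exact: translate_continuous.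
    exact: cut_left_continuous.
  by move=> u /(near_optimal_block p N) /=; lra.
have [b b0 bP] := @band_bounded _ _ _ G _ (@cut_right_continuous _ _ _ G v).
have [b' b0' bP'] := @band_bounded _ _ _ G _ (@cut_left_continuous _ _ _ G w).
have UB' p N : S p N U <= c + b + b'.
  have := bP _ (band_translate p bU).
  have := bP' _ (band_translate (p + N%:Z) bU).
  by rewrite !ler_norml => /andP[_ h1] /andP[_ h2]; have := UB p N; lra.
have homo k k' x : (k <= k')%R -> U (sh k x) <= U (sh k' x).
  move=> kk'; have -> : k' = k + (absz (k' - k)%R)%:Z by lia.
  elim: (absz _) => [|j IH]; first by rewrite addr0.
  apply: le_trans IH _; have -> : k + j.+1%:Z = 1 + (k + j%:Z) by lia.
  by rewrite -(slideD C 1 (k + j%:Z)); exact: mU.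
have uvw y : v y <= U y <= w y := proj2 bU y.
pose Zp x : R := lim (U (sh k%:Z x) @[k --> \oo]).
have cZp x : U (sh k%:Z x) @[k --> \oo] --> Zp x.
  apply: nondecreasing_is_cvgn; first by move=> k k' kk'; apply: homo.
  exists (w x) => _ [k _ <-]; rewrite -(w_inv k).
  by have /andP[] := uvw (sh k x).
pose Zm x : R := lim (U (sh (- k%:Z) x) @[k --> \oo]).
have cZm x : U (sh (- k%:Z) x) @[k --> \oo] --> Zm x.
  apply: nonincreasing_is_cvgn; first by move=> k k' kk'; apply: homo; lia.
  exists (v x) => _ [k _ <-]; rewrite -(v_inv (- k%:Z)).
  by have /andP[] := uvw (sh (- k%:Z) x).
have bZ (t : nat -> int) Z : (forall x, U (sh (t k) x) @[k --> \oo] --> Z x) ->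
    band G Z.
  move=> UZ; apply: (@closed_cvg nat T \oo _ (fun k => tr (t k) U) (band G)).
  - exact: band_closed.
  - by near=> k; exact: band_translate.
  - by apply: cvg_pointwise; exact: UZ.
have Zpinv x : Zp (sh 1 x) = Zp x.
  have h : U (sh k%:Z (sh 1 x)) @[k --> \oo] --> Zp x.
    have := cZp x; rewrite -(cvg_shiftS (fun k : nat => U (sh k%:Z x))).
    apply: cvg_trans; apply: near_eq_cvg; apply: nearW => k /=.
    by rewrite slideD; congr (U (sh _ x)); lia.
  exact: (@cvg_lim R _ nat \oo _ _ _ h).
have Zminv x : Zm (sh 1 x) = Zm x.
  have h : U (sh (- k%:Z) x) @[k --> \oo] --> Zm (sh 1 x).
    have := cZm (sh 1 x).
    rewrite -(cvg_shiftS (fun k : nat => U (sh (- k%:Z) (sh 1 x)))).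
    apply: cvg_trans; apply: near_eq_cvg; apply: nearW => k /=.
    by rewrite slideD; congr (U (sh _ x)); lia.
  by apply/esym; exact: (@cvg_lim R _ nat \oo _ _ _ h).
have [Pp Zpvw] := bZ _ _ cZp; have [Pm Zmvw] := bZ _ _ cZm.
have Ep : energy C 0 Zp = 0.
  apply: (@eventual_energy_eq0 U Zp Posz (c + b + b')) => // k N.
  apply: le_trans (UB' k%:Z N); rewrite /block.
  by under eq_bigr do rewrite PoszD.
have Em : energy C 0 Zm = 0.
  apply: (@eventual_energy_eq0 U Zm (fun k => - k%:Z) (c + b + b')) => // k N.
  apply: le_trans (UB' (- (k + N)%:Z + 1) N); rewrite /block.
  rewrite (reindex_inj rev_ord_inj) /=; apply: ler_sum => j _.
  suff -> : - (k + (N - j.+1))%N%:Z = - (k + N)%:Z + 1 + j%:Z by [].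
  by have := ltn_ord j; lia.
have Zpw : Zp = w.
  have [Zv|//] := gap_empty Pp Zpvw Zpinv Ep.
  have : U (sh 1 o) <= Zp o.
    apply: limr_ge; first exact: cZp.
    by exists 1%N => // k k1; apply: homo; rewrite lez_nat.
  by rewrite Zv => /(le_trans Uo1); rewrite leNgt v_mid.
have Zmv : Zm = v.
  have [//|Zw] := gap_empty Pm Zmvw Zminv Em.
  have : Zm o <= U o.
    apply: limr_le; first exact: cZm.
    by exists 0%N => // k k1; rewrite -[in leRHS](slide0 C o); apply: homo; lia.
  by rewrite Zw => /le_trans/(_ Uo); rewrite leNgt mid_w.
have cU : connection G U by split => //; [rewrite -Zmv|rewrite -Zpw].
(* the cut costs in [UB] vanish far away, so [U] is optimal *)
exists U; apply: minimal_of_frequently => // e K e0.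
have [_ hl] := cut_cvg_lower cU; have [hr _] := cut_cvg_upper cU.
have := cvg_prod_err hl hr => /(cvgr_le _)/(_ _ e0)/near_pairP[K1 K1P].
exists (K + K1, K + K1)%N; first by split => /=; lia.
have := K1P (K + K1, K + K1)%N ltac:(split => /=; lia).
have := UB (- (K + K1)%:Z) (K + K1 + (K + K1)).+1.
have -> : - (K + K1)%:Z + (K + K1 + (K + K1)).+1%:Z = (K + K1).+1%:Z by lia.
rewrite /partial_sum /=; lra.
Unshelve. all: by end_near.
Qed.

Lemma minimal_near U e : minimal G U -> 0 < e ->
  \forall x \near P, psum U x <= c + e.
Proof. by move=> [_ cU] e0; apply: (cvgr_le _ cU); lra. Qed.

Lemma connection_min U V : connection G U -> connection G V ->
  connection G (cmin U V).
Proof.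
move=> [bU Uv Uw] [bV Vv Vw]; have [_ Ub] := bU; have [_ Vb] := bV.
split => [|x|x]; first exact: band_min.
  apply: (squeeze_cvgr _ (cvg_cst _) (Uv x)); apply: nearW => k.
  rewrite /cmin le_min ge_min lexx andbT -(v_inv (- k%:Z)).
  have /andP[-> _] := Ub (sh (- k%:Z) x).
  by have /andP[-> _] := Vb (sh (- k%:Z) x).
have h : U (sh k%:Z x) + V (sh k%:Z x) - w x @[k --> \oo] --> w x.
  by rewrite -[X in _ --> X](addrK (w x)); apply: cvgB (cvg_cst _); apply: cvgD.
apply: (squeeze_cvgr _ h (cvg_cst (w x))); apply: nearW => k.
rewrite /cmin ge_min le_min -(w_inv k%:Z).
have /andP[_ h1] := Ub (sh k%:Z x); have /andP[_ h2] := Vb (sh k%:Z x).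
by rewrite h1; apply/andP; split => //; apply/andP; split; lra.
Qed.

Lemma connection_max U V : connection G U -> connection G V ->
  connection G (cmax U V).
Proof.
move=> [bU Uv Uw] [bV Vv Vw]; have [_ Ub] := bU; have [_ Vb] := bV.
split => [|x|x]; first exact: band_max; last first.
  apply: (squeeze_cvgr _ (Uw x) (cvg_cst (w x))); apply: nearW => k.
  rewrite /cmax ge_max le_max lexx /= -(w_inv k%:Z).
  by have /andP[_ ->] := Ub (sh k%:Z x); have /andP[_ ->] := Vb (sh k%:Z x).
have h : U (sh (- k%:Z) x) + V (sh (- k%:Z) x) - v x @[k --> \oo] --> v x.
  by rewrite -[X in _ --> X](addrK (v x)); apply: cvgB (cvg_cst _); apply: cvgD.
apply: (squeeze_cvgr _ (cvg_cst (v x)) h); apply: nearW => k.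
rewrite /cmax ge_max le_max -(v_inv (- k%:Z)).
have /andP[h1 _] := Ub (sh (- k%:Z) x); have /andP[h2 _] := Vb (sh (- k%:Z) x).
by rewrite h1; apply/andP; split => //; apply/andP; split; lra.
Qed.

Lemma partial_sum_submodular U V x :
  psum (cmin U V) x + psum (cmax U V) x <= psum U x + psum V x.
Proof. exact: block_submodular. Qed.

Lemma minimal_of_submodular U V A B : minimal G U -> minimal G V ->
  connection G A -> connection G B ->
  (forall x, psum A x + psum B x <= psum U x + psum V x) -> minimal G A.
Proof.
move=> mU mV cA cB AB; apply: minimal_of_frequently => // e K e0.
have e3 : 0 < e / 3 by lra.
have [K1 K1P] := near_pairP (partial_sum_ge_near cB e3).
have [K2 K2P] := near_pairP (minimal_near mU e3).
have [K3 K3P] := near_pairP (minimal_near mV e3).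
pose L := (K + K1 + K2 + K3)%N; exists (L, L); first by split => /=; lia.
have := K1P (L, L) ltac:(split => /=; lia).
have := K2P (L, L) ltac:(split => /=; lia).
have := K3P (L, L) ltac:(split => /=; lia).
have := AB (L, L); lra.
Qed.

Lemma minimal_min_max U V : minimal G U -> minimal G V ->
  minimal G (cmin U V) /\ minimal G (cmax U V).
Proof.
move=> mU mV; have [cU _] := mU; have [cV _] := mV.
have cm := connection_min cU cV; have cM := connection_max cU cV.
split.
  exact: (minimal_of_submodular mU mV cm cM (partial_sum_submodular U V)).
apply: (minimal_of_submodular mU mV cM cm) => x.
by rewrite addrC; exact: partial_sum_submodular.
Qed.

Lemma minimal_translate U : minimal G U -> minimal G (tr 1 U).
Proof.
move=> mU; have [[bU Uv Uw] _] := mU.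
have slide_comm m k x : sh m (sh k x) = sh k (sh m x).
  by rewrite !slideD addrC.
apply: minimal_of_frequently => [|e K e0].
  split; first exact: band_translate.
    move=> x; rewrite -(v_inv 1) /translate.
    by under eq_cvg do rewrite slide_comm; exact: Uv.
  move=> x; rewrite -(w_inv 1) /translate.
  by under eq_cvg do rewrite slide_comm; exact: Uw.
have [K1 K1P] := near_pairP (minimal_near mU e0).
exists ((K + K1).+1, K + K1)%N; first by split => /=; lia.
apply: le_trans (K1P (K + K1, (K + K1).+1)%N ltac:(split => /=; lia)).
rewrite /partial_sum block_slide /=.
suff -> : - (K + K1).+1%:Z + 1 = - (K + K1)%:Z by rewrite addSn addnS.
lia.
Qed.

(** A local change of a connection is a connection, and changes all large
partial sums by the same amount. *)
Lemma minimal_local p N U u : minimal G U -> band G u ->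
  (forall x, lay x < p \/ p + N%:Z <= lay x -> u x = U x) ->
  S (p - rho%:Z) (N + 2 * rho) U <= S (p - rho%:Z) (N + 2 * rho) u.
Proof.
move=> mU bu uU; have [[bU Uv Uw] _] := mU.
have cu : connection G u.
  split => // x.
    apply: cvg_trans (Uv x); apply: near_eq_cvg.
    exists (absz (p - lay x)%R + 1)%N => // k /= kl.
    by rewrite uU// layer_slide; lia.
  apply: cvg_trans (Uw x); apply: near_eq_cvg.
  exists (absz (p + N%:Z - lay x)%R + 1)%N => // k /= kl.
  by rewrite uU// layer_slide; lia.
apply/ler_addgt0Pr => e e0; have e2 : 0 < e / 2 by lra.
have [K1 K1P] := near_pairP (partial_sum_ge_near cu e2).
have [K2 K2P] := near_pairP (minimal_near mU e2).
pose L := (K1 + K2 + absz p + N + rho)%N.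
have := K1P (L, L) ltac:(split => /=; lia).
have := K2P (L, L) ltac:(split => /=; lia).
rewrite /partial_sum /=.
pose A := absz (p - rho%:Z + L%:Z)%R.
pose B := absz (L%:Z + 1 - p - N%:Z - rho%:Z)%R.
have -> : (L + L).+1 = (A + (N + 2 * rho) + B)%N by rewrite /A /B /L; lia.
rewrite !(blockD _ _ (A + _)) !(blockD _ _ A).
have pA : - L%:Z + A%:Z = p - rho%:Z by rewrite /A /L; lia.
rewrite pA.
have -> : S (- L%:Z) A u = S (- L%:Z) A U.
  by apply: block_local => x xl; apply: uU; lia.
have -> : S (- L%:Z + (A + (N + 2 * rho))%N%:Z) B u =
    S (- L%:Z + (A + (N + 2 * rho))%N%:Z) B U.
  by apply: block_local => x xl; apply: uU; lia.
lra.
Qed.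

End Minimal.

(** * Lower limits of double sequences *)

Section LowerLimit.
Context {R : realType}.
Variable f : nat * nat -> R.
Local Notation P := (filter_prod (\oo : set_system nat) (\oo : set_system nat)).
Local Notation liminf := (limf_einf (fun x => (f x)%:E) P).

Lemma limf_einf_ge (c : R) :
  (forall e, 0 < e -> \forall x \near P, c - e <= f x) ->
  (c%:E <= liminf)%E.
Proof.
move=> h; rewrite limf_einfE; apply/lee_subgt0Pr => e e0.
apply: le_ereal_sup_tmp.
exists (ereal_inf [set (f x)%:E | x in [set x | c - e <= f x]]).
  by exists [set x | c - e <= f x] => //; exact: h.
by apply/ereal_infP => _ [x xe <-]; rewrite -EFinB lee_fin.
Qed.

Lemma limf_einf_le (c : R) :
  (forall e, 0 < e -> \forall x \near P, f x <= c + e) ->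
  (liminf <= c%:E)%E.
Proof.
move=> h; rewrite limf_einfE; apply/lee_addgt0Pr => e e0.
apply/ereal_supP => _ [V PV <-].
have [x [Vx fx]] := filter_ex (filterI PV (h e e0)).
apply: ge_ereal_inf; exists (f x)%:E; first by exists x.
by rewrite -EFinD lee_fin.
Qed.

Lemma limf_einf_frequently (c e : R) K : (liminf <= c%:E)%E -> 0 < e ->
  exists2 x : nat * nat, (K <= x.1)%N /\ (K <= x.2)%N & f x <= c + e.
Proof.
rewrite limf_einfE => lc e0; apply: contrapT => h.
have : ((c + e)%:E <= c%:E)%E; last by rewrite lee_fin; lra.
apply: le_trans lc; apply: le_ereal_sup_tmp.
pose far := [set x : nat * nat | (K <= x.1)%N /\ (K <= x.2)%N].
exists (ereal_inf [set (f x)%:E | x in far]).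
  by exists far => //; exact: near_pair_near.
apply/ereal_infP => _ [x xK <-]; rewrite lee_fin leNgt; apply/negP => lt.
by apply: h; exists x => //; exact: ltW.
Qed.

End LowerLimit.

(** * Submodularity from the sign of the mixed partials *)

Section OneSidedDerivative.
Context {R : realType}.
Implicit Types (f : R -> R) (x d : R).

Lemma difference_quotient_cvg f x : derivable f x 1 ->
  h^-1 *: (f (h + x) - f x) @[h --> 0^'] --> derive1 f x.
Proof.
move=> df; suff : cvg (h^-1 *: (f (h + x) - f x) @[h --> 0^']) by [].
rewrite (_ : (fun h => _) =
  (fun h : R => h^-1 *: (f (h *: (1 : R) + x) - f x)))//.
by apply/funext => h; rewrite /GRing.scale /= mulr1.
Qed.

Lemma derive1_ge0_right_min f x d : derivable f x 1 -> 0 < d ->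
  (forall t, 0 < t -> t < d -> f x <= f (x + t)) -> 0 <= derive1 f x.
Proof.
move=> /difference_quotient_cvg/cvg_dnbhs_at_right cf d0 fmin.
apply: (@closed_cvg _ _ _ _ _ (fun y : R => 0 <= y) _ _ _ cf).
  exact: closed_ge.
near=> h; have h0 : 0 < h by near: h; exact: nbhs_right_gt.
apply: mulr_ge0; first by rewrite invr_ge0 ltW.
rewrite subr_ge0.
by rewrite (addrC h x) fmin//; near: h; exact: nbhs_right_lt.
Unshelve. all: by end_near.
Qed.

Lemma derive1_le0_left_min f x d : derivable f x 1 -> 0 < d ->
  (forall t, 0 < t -> t < d -> f x <= f (x - t)) -> derive1 f x <= 0.
Proof.
move=> /difference_quotient_cvg/cvg_dnbhs_at_left cf d0 fmin.
apply: (@closed_cvg _ _ _ _ _ (fun y : R => y <= 0) _ _ _ cf).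
  exact: closed_le.
near=> h; have h0 : h < 0 by near: h; exact: nbhs_left_lt.
apply: mulr_le0_ge0; first by rewrite invr_le0 ltW.
rewrite subr_ge0.
rewrite (addrC h x) -[h]opprK fmin ?oppr_gt0// ltrNl.
by near: h; apply: nbhs_left_gt; rewrite oppr_lt0.
Unshelve. all: by end_near.
Qed.

Lemma is_derive_sumr (J : Type) (l : seq J) (F : J -> R -> R) (dF : J -> R)
    (x : R) :
  (forall j, is_derive x 1 (F j) (dF j)) ->
  is_derive x 1 (fun t => \sum_(j <- l) F j t) (\sum_(j <- l) dF j).
Proof.
move=> dFj; elim: l => [|j l IH].
  rewrite big_nil; under eq_fun do rewrite big_nil.
  exact: is_derive_cst.
rewrite big_cons; under eq_fun do rewrite big_cons.
exact: is_deriveD.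
Qed.

End OneSidedDerivative.

Section Partials.
Context {R : realType} {I : finType}.
Implicit Types (u y : I -> R) (i j k : I) (f g : (I -> R) -> R).
Local Notation upd := (@dfwith I (fun=> R)).

Lemma updE u i t k : upd u i t k = if k == i then t else u k.
Proof.
by case: dfwithP => [|j ij]; [rewrite eqxx|rewrite eq_sym (negbTE ij)].
Qed.

Lemma upd_id u i : upd u i (u i) = u.
Proof. by apply/funext => k; rewrite updE; case: eqP => // ->. Qed.

Lemma upd_upd u i t t' : upd (upd u i t) i t' = upd u i t'.
Proof. by apply/funext => k; rewrite !updE; case: eqP. Qed.

Lemma line_derivable f i u t : (forall u, has_partial i f u) ->
  derivable (fun t => f (upd u i t)) t 1.
Proof.
move=> df; have := df (upd u i t); rewrite /has_partial updE eqxx.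
by under eq_fun do rewrite upd_upd.
Qed.

Lemma line_derive1 f i u t :
  derive1 (fun t => f (upd u i t)) t = partial i f (upd u i t).
Proof.
by rewrite /partial updE eqxx; congr (derive1 _ t); apply/funext => t';
  rewrite upd_upd.
Qed.

Lemma line_nonincreasing f i u t t' : (forall u, has_partial i f u) ->
  (forall u, partial i f u <= 0) -> t <= t' -> f (upd u i t') <= f (upd u i t).
Proof.
move=> df f0 tt'.
have df' x : x \in `]t, t'[ -> derivable (fun t => f (upd u i t)) x 1.
  by move=> _; exact: line_derivable.
apply: (@ler0_derive1_le_cc R (fun t => f (upd u i t)) t t') => //.
- by move=> x _; rewrite line_derive1.
- by apply: derivable_within_continuous => x _; exact: line_derivable.
- by rewrite in_itv /= lexx tt'.
- by rewrite in_itv /= lexx tt'.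
Qed.

Lemma line_decreasing f i u t t' : (forall u, has_partial i f u) ->
  (forall u, partial i f u < 0) -> t < t' -> f (upd u i t') < f (upd u i t).
Proof.
move=> df f0 tt'.
have df' x : x \in `]t, t'[ -> derivable (fun t => f (upd u i t)) x 1.
  by move=> _; exact: line_derivable.
apply: (@ltr0_derive1_lt_cc R (fun t => f (upd u i t)) t t') => //.
- by move=> x _; rewrite line_derive1.
- by apply: derivable_within_continuous => x _; exact: line_derivable.
- by rewrite in_itv /= lexx ltW.
- by rewrite in_itv /= lexx ltW.
Qed.

(** Move from [u] to [u'] one coordinate at a time. *)
Lemma nonincreasing_off g i u u' :
  (forall j, j != i -> forall u, has_partial j g u) ->
  (forall j, j != i -> forall u, partial j g u <= 0) ->
  (forall k, u k <= u' k) -> u i = u' i -> g u' <= g u.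
Proof.
move=> dg g0 uu' ui.
pose mix (l : seq I) k := if k \in l then u' k else u k.
have step l : g (mix l) <= g u.
  elim: l => [|k l IH]; first exact: lexx.
  apply: le_trans IH.
  have -> : mix (k :: l) = upd (mix l) k (u' k).
    apply/funext => j; rewrite updE /mix inE.
    by case: eqP => [->|].
  have [->|ki] := eqVneq k i.
    rewrite -ui (_ : upd _ _ _ = mix l)//.
    apply/funext => j; rewrite updE; case: eqP => // ->.
    by rewrite /mix; case: ifP.
  rewrite -[X in _ <= g X](upd_id _ k); apply: line_nonincreasing.
  - exact: dg.
  - exact: g0.
  - by rewrite /mix; case: ifP.
rewrite (_ : u' = mix (enum I)) //.
by apply/funext => k; rewrite /mix mem_enum.
Qed.

Lemma decreasing_off g i j u u' : j != i ->
  (forall j, j != i -> forall u, has_partial j g u) ->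
  (forall j, j != i -> forall u, partial j g u <= 0) ->
  (forall u, partial j g u < 0) ->
  (forall k, u k <= u' k) -> u i = u' i -> u j < u' j -> g u' < g u.
Proof.
move=> ji dg g0 gj uu' ui uj.
apply: (@le_lt_trans _ _ (g (upd u j (u' j)))).
  apply: (@nonincreasing_off g i) => //.
    by move=> k; rewrite updE; case: eqP => // ->.
  by rewrite updE eq_sym (negbTE ji).
rewrite -[X in _ < g X](upd_id _ j); apply: line_decreasing => //.
exact: dg.
Qed.

Section Submodular.
Variable f : (I -> R) -> R.
Hypothesis df : forall i u, has_partial i f u.
Hypothesis ddf : forall i j u, has_partial j (partial i f) u.
Hypothesis cross_le0 : forall i j, j != i -> forall u,
  partial j (partial i f) u <= 0.

(** The derivative in [t] of the difference of the two sides is a difference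
of values of one partial derivative, which has the right sign by
[nonincreasing_off]. *)
Lemma decreasing_differences i u u' t t' : (forall k, u k <= u' k) -> t <= t' ->
  f (upd u' i t') - f (upd u' i t) <= f (upd u i t') - f (upd u i t).
Proof.
move=> uu' tt'.
pose D t := f (upd u' i t) - f (upd u i t).
have dD x : derivable D x 1.
  by apply: derivableB; exact: line_derivable.
suff : D t' <= D t by rewrite /D; lra.
apply: (@ler0_derive1_le_cc R D t t') => //.
- move=> x _; rewrite derive1E deriveB; try exact: line_derivable.
  rewrite -!derive1E !line_derive1 subr_le0.
  apply: (@nonincreasing_off (partial i f) i).
  + by move=> j _; exact: ddf.
  + by move=> j ji; exact: cross_le0.
  + by move=> k; rewrite !updE; case: ifP.
  + by rewrite !updE eqxx.
- exact: derivable_within_continuous.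
- by rewrite in_itv /= lexx tt'.
- by rewrite in_itv /= lexx tt'.
Qed.

(** Raise the coordinates where [u < u'] one at a time, starting once from the
minimum, which leads to [u'], and once from [u], which leads to the maximum;
each raise gains no more in the second case. *)
Lemma submodular_of_partials u u' :
  f (fun k => Num.min (u k) (u' k)) + f (fun k => Num.max (u k) (u' k)) <=
  f u + f u'.
Proof.
set m := fun k => Num.min _ _; set M := fun k => Num.max _ _.
pose mix (z : I -> R) (l : seq I) k :=
  if (k \in l) && (u k < u' k) then u' k else z k.
have step l : f (mix u l) - f u <= f (mix m l) - f m.
  elim: l => [|k l IH].
    by rewrite (_ : mix u [::] = u) // (_ : mix m [::] = m) // !subrr.
  have [ku'|u'k] := ltP (u k) (u' k); last first.
    have mixk z : mix z (k :: l) = mix z l.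
      apply/funext => j; rewrite /mix inE.
      by case: eqP => // ->; rewrite ltNge u'k !andbF.
    by rewrite !mixk.
  have [kl|kl] := boolP (k \in l).
    have mixk z : mix z (k :: l) = mix z l.
      by apply/funext => j; rewrite /mix inE; case: eqP => // ->; rewrite kl.
    by rewrite !mixk.
  have mixk z : mix z (k :: l) = upd (mix z l) k (u' k).
    apply/funext => j; rewrite updE /mix inE.
    by case: eqP => // ->; rewrite ku'.
  have mixl z : mix z l = upd (mix z l) k (z k).
    apply/funext => j; rewrite updE; case: eqP => // ->.
    by rewrite /mix (negbTE kl).
  have mk : m k = u k by rewrite /m minEle ltW.
  have := @decreasing_differences k (mix m l) (mix u l) (u k) (u' k).
  rewrite -!mixk -[in X in _ -> _ -> _ - f X <= _]mixl.
  rewrite -[in X in _ -> _ -> _ <= _ - f X]mk.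
  rewrite -[in X in _ -> _ -> _ <= _ - f X]mixl.
  have mle j : mix m l j <= mix u l j.
    by rewrite /mix; case: ifP => // _; rewrite /m ge_min lexx.
  by move=> /(_ mle (ltW ku')); lra.
have := step (enum I).
have -> : mix u (enum I) = M.
  by apply/funext => k; rewrite /mix /M mem_enum /= maxElt.
have -> : mix m (enum I) = u'.
  by apply/funext => k; rewrite /mix /m mem_enum /= minElt; case: (u k < u' k).
lra.
Qed.

(** The maximum of the configurations raised at one site each is raised at all
of them, so submodularity applies; for negative [t] minima and maxima exchange
their roles. This replaces the chain rule for directional derivatives along
several coordinates. *)
Lemma raise_subadditive (P : pred I) u t :
  f (fun k => if P k then u k + t else u k) - f u <=
  \sum_(k | P k) (f (upd u k (u k + t)) - f u).
Proof.
pose up (l : seq I) k := if k \in l then u k + t else u k.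
have step l : uniq l ->
    f (up l) - f u <= \sum_(k <- l) (f (upd u k (u k + t)) - f u).
  elim: l => [_|k l IH /= /andP[kl ul]]; first by rewrite big_nil subrr.
  rewrite big_cons; have := submodular_of_partials (up l) (upd u k (u k + t)).
  have rk : up (k :: l) = fun j => if j == k then u k + t else up l j.
    by apply/funext => j; rewrite /up inE; case: eqP => // ->.
  have [t0|t0] := leP 0 t.
    have -> : (fun j => Num.min (up l j) (upd u k (u k + t) j)) = u.
      apply/funext => j; rewrite updE /up; case: eqP => [->|_].
        by rewrite (negbTE kl); apply/min_idPl; lra.
      by case: ifP => _; [apply/min_idPr; lra|rewrite minxx].
    have -> : (fun j => Num.max (up l j) (upd u k (u k + t) j)) =
        up (k :: l).
      apply/funext => j; rewrite rk updE /up; case: eqP => [->|_].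
        by rewrite (negbTE kl); apply/max_idPr; lra.
      by case: ifP => _; [apply/max_idPl; lra|rewrite maxxx].
    by have := IH ul; lra.
  have -> : (fun j => Num.max (up l j) (upd u k (u k + t) j)) = u.
    apply/funext => j; rewrite updE /up; case: eqP => [->|_].
      by rewrite (negbTE kl); apply/max_idPl; lra.
    by case: ifP => _; [apply/max_idPr; lra|rewrite maxxx].
  have -> : (fun j => Num.min (up l j) (upd u k (u k + t) j)) =
        up (k :: l).
    apply/funext => j; rewrite rk updE /up; case: eqP => [->|_].
      by rewrite (negbTE kl); apply/min_idPr; lra.
    by case: ifP => _; [apply/min_idPl; lra|rewrite minxx].
  by have := IH ul; lra.
have := step (enum P) (enum_uniq P).
rewrite big_enum_cond /=.
rewrite (_ : up (enum P) = fun k => if P k then u k + t else u k).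
  by under eq_bigl do rewrite andbT.
by apply/funext => k; rewrite /up mem_enum.
Qed.

End Submodular.
End Partials.

(** * The Euler-Lagrange equation and comparison of its solutions *)

Section Stencil.
Context {R : realType} {n r : nat}.
Local Notation Zn := 'rV[int]_n.+1.
Local Notation conf := (Zn -> R).
Local Notation B := (B0 (n := n) r).
Local Notation upd := (@dfwith B (fun=> R)).
Variable s : (B -> R) -> R.
Hypothesis s_adm : admissible s.

Definition window (j : Zn) (u : conf) : B -> R := fun k => u (val k + j).

Lemma window_center (k : B) i u : window (i - val k) u k = u i.
Proof. by rewrite /window (addrC (val k)) subrK. Qed.

Lemma SlocE j u : Sloc s j u = s (window j u).
Proof. by rewrite /Sloc; congr s; apply/funext => k; rewrite tausE. Qed.

Lemma norm1N (i : Zn) : norm1 (- i) = norm1 i.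
Proof. by apply: eq_bigr => k _; rewrite mxE normrN. Qed.

Lemma norm10 : norm1 (0 : Zn) = 0.
Proof. by apply: big1 => k _; rewrite mxE normr0. Qed.

Lemma norm1_evec (k : 'I_n.+1) : norm1 (evec k) = 1.
Proof.
rewrite /norm1 (bigD1 k)//= big1 => [|l lk].
  by rewrite /evec mxE !eqxx /= normr1 addr0.
by rewrite /evec mxE (negbTE lk) andbF normr0.
Qed.

Lemma coord_le_norm1 (i : Zn) k : `|i 0 k| <= norm1 i.
Proof. by rewrite /norm1 (bigD1 k)//= lerDl sumr_ge0. Qed.

Lemma stencil_norm (k : B) : norm1 (val k) <= r%:Z.
Proof. by have := valP k; rewrite in_B0. Qed.

Lemma partial_Sloc (k : B) j u :
  partial (val k + j) (Sloc s j) u = partial k s (window j u).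
Proof.
rewrite /partial; congr (derive1 _ _); apply/funext => t.
rewrite SlocE; congr s; apply/funext => l; rewrite /window updE.
case: eqP => [->|lk]; first by rewrite dfwithin.
rewrite dfwithout//; apply/eqP => /addIr/val_inj kl; exact: lk.
Qed.

Definition EL_sum (u : conf) (i : Zn) : R :=
  \sum_(k : B) partial k s (window (i - val k) u).

Lemma fsbig_fintype (J : finType) (F : J -> R) :
  \sum_(k \in [set: J]) F k = \sum_k F k.
Proof.
rewrite -big_enum /= [RHS]fsbig_seq ?enum_uniq//; apply: eq_fsbigl.
by apply/seteqP; split => x //= _; rewrite mem_enum.
Qed.

Lemma EL_solutionE u : EL_solution s u <-> forall i, EL_sum u i = 0.
Proof.
have E i : \sum_(j \in lball i r) partial i (Sloc s j) u = EL_sum u i.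
  rewrite (reindex_fsbig (fun k : B => i - val k) [set: B]); last first.
    split.
    - by move=> k _; rewrite /lball /= addrC addKr norm1N stencil_norm.
    - by move=> k l _ _ /addrI/oppr_inj/val_inj.
    - move=> j; rewrite /lball /= => ji.
      have kB : i - j \in B by rewrite in_B0 -norm1N opprB.
      by exists [` kB]%fset => //=; rewrite opprB addrC subrK.
  rewrite /EL_sum -fsbig_fintype; apply: eq_fsbigr => k _.
  by rewrite -partial_Sloc (addrC (val k)) subrK.
by split=> h i; have := h i; rewrite E.
Qed.

Lemma potential_partials (k : B) u : has_partial k s u.
Proof. by have [[_ /(_ k)[+ _]] _ _ _] := s_adm. Qed.

Lemma potential_second_partials (k l : B) u : has_partial l (partial k s) u.
Proof. by have [[_ /(_ k)[_ [_ /(_ l)[+ _]]]] _ _ _] := s_adm. Qed.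

Lemma potential_cross_le0 (k l : B) : l != k -> forall u,
  partial l (partial k s) u <= 0.
Proof. by have [_ _ _ [h _]] := s_adm; exact: h. Qed.

Lemma EL_sum_le u u' i : cle u u' -> u i = u' i -> EL_sum u' i <= EL_sum u i.
Proof.
move=> uu' ui; apply: ler_sum => k _.
apply: (@nonincreasing_off _ _ (partial k s) k).
- by move=> l _; exact: potential_second_partials.
- exact: potential_cross_le0.
- by move=> l; exact: uu'.
- by rewrite !window_center.
Qed.

(** All terms of the two sums are ordered by [EL_sum_le], and the term whose
window is centred at the neighbour [i + d] is strictly so if the two
configurations differ there: the central coordinate enters it through the
strict inequality for the mixed partials. *)
Lemma EL_sum_neighbour u u' i d : (0 < r)%N -> norm1 d = 1 -> cle u u' ->
  u i = u' i -> EL_sum u i = EL_sum u' i -> u (i + d) = u' (i + d).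
Proof.
move=> r_gt0 d1 uu' ui Eu; apply/eqP; rewrite eq_le uu' /= leNgt.
apply/negP => lt.
have kB : - d \in B0 r by rewrite in_B0 norm1N d1.
have oB : (0 : Zn) \in B0 r by rewrite in_B0 norm10.
(* the coordinate [k] of the window centred at [i + d] is the site [i], its
   coordinate [o] is [i + d] itself *)
pose k : B := [` kB]%fset; pose o : B := [` oB]%fset.
have ok : o != k.
  by apply/eqP => /(congr1 (norm1 \o val)) /=; rewrite norm10 norm1N d1.
have [_ _ _ [_ strict]] := s_adm.
suff : EL_sum u' i < EL_sum u i by rewrite Eu ltxx.
rewrite /EL_sum (bigD1 k)//= [ltRHS](bigD1 k)//= ltr_leD//.
  apply: (@decreasing_off _ _ (partial k s) k o) => //.
  - by move=> l _; exact: potential_second_partials.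
  - exact: potential_cross_le0.
  - by move=> z; apply: strict; rewrite /= ?norm1N.
  - by move=> l; exact: uu'.
  - apply: etrans (window_center k i u) _; rewrite ui.
    exact: esym (window_center k i u').
  - by rewrite /window /= opprK add0r.
apply: ler_sum => l _; apply: (@nonincreasing_off _ _ (partial l s) l).
- by move=> m _; exact: potential_second_partials.
- exact: potential_cross_le0.
- by move=> m; exact: uu'.
- by rewrite !window_center.
Qed.

Lemma lattice_connected (Q : Zn -> Prop) i :
  (forall j d, norm1 d = 1 -> Q j -> Q (j + d)) -> Q i -> forall j, Q j.
Proof.
move=> step Qi j.
have along k (m : int) l : Q l -> Q (l + m *: evec k).
  have alongn (c : nat) d : norm1 d = 1 -> Q l -> Q (l + d *+ c).
    move=> d1 Ql; elim: c => [|c IH]; first by rewrite addr0.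
    by rewrite mulrSr addrA; exact: step.
  case: m => c Ql.
    by have := alongn c _ (norm1_evec k) Ql; rewrite -scaler_nat natz.
  have := alongn c.+1 (- evec k) _ Ql.
  by rewrite norm1N norm1_evec mulNrn NegzE scaleNr -scaler_nat natz; exact.
have -> : j = i + \sum_(k <- enum 'I_n.+1) (j - i) 0 k *: evec k.
  by rewrite big_enum /= -row_sum_delta addrC subrK.
move: (j - i) => d; elim: (enum _) i Qi => [|k l IH] i' Qi'.
  by rewrite big_nil addr0.
by rewrite big_cons addrA; apply/IH/along.
Qed.

(** The strong comparison principle: agreement spreads from a site to its
neighbours, hence to the whole lattice. *)
Lemma EL_comparison u u' i : (0 < r)%N -> EL_solution s u -> EL_solution s u' ->
  cle u u' -> u i = u' i -> u = u'.
Proof.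
move=> r_gt0 /EL_solutionE su /EL_solutionE su' uu' ui; apply/funext.
apply: (@lattice_connected (fun j => u j = u' j) i) => // j d d1 uj.
by apply: EL_sum_neighbour => //; rewrite su su'.
Qed.

Lemma window_derivable (k : B) j u :
  derivable (fun t => s (upd (window j u) k t)) (window j u k) 1.
Proof. exact: potential_partials. Qed.

(** The change of the total energy when the value at the single site [i] is
set to [t]. *)
Definition site_energy (u : conf) (i : Zn) (t : R) : R :=
  \sum_(k : B) (s (upd (window (i - val k) u) k t) - s (window (i - val k) u)).

Lemma site_energy_is_derive (u : conf) (i : Zn) :
  is_derive (u i) 1 (site_energy u i) (EL_sum u i).
Proof.
apply: is_derive_sumr => k.
have wk := window_center k i u.
have dk := @window_derivable k (i - val k) u; rewrite wk in dk.
rewrite -[partial _ _ _]subr0; apply: is_deriveB => //.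
by rewrite /partial wk derive1E; exact/derivableP.
Qed.

Lemma site_energy_self u i : site_energy u i (u i) = 0.
Proof.
apply: big1 => k _; rewrite (_ : upd _ _ _ = window (i - val k) u) ?subrr//.
by rewrite -[RHS](upd_id _ k) window_center.
Qed.

End Stencil.

(** * The layered structure of the lattice energy *)

Section LatticeEnergy.
Context {R : realType} {n r : nat}.
Local Notation Zn := 'rV[int]_n.+1.
Local Notation conf := (Zn -> R).
Local Notation B := (B0 (n := n) r).
Local Notation upd := (@dfwith B (fun=> R)).
Variable s : (B -> R) -> R.
Hypothesis s_adm : admissible s.
Variable alpha : 'rV[rat]_n.+1.
Local Notation P := (per alpha).
Local Notation co x k := (fun_of_matrix x 0%R k).
Local Notation tilt := (tilt alpha).

Lemma per_gt0 k : 0 < P k.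
Proof. exact: denq_gt0. Qed.

Lemma potential_shift (c : int) (y : B -> R) :
  s (fun k => y k + c%:~R) = s y.
Proof.
have [_ s1 _ _] := s_adm.
have sn (m : nat) z : s (fun k => z k + m%:R) = s z.
  elim: m => [|m <-]; first by congr s; apply/funext => k; rewrite addr0.
  by rewrite -[RHS]s1; congr s; apply/funext => k; rewrite -addrA -natr1.
case: c => m; first exact: sn.
rewrite NegzE -[LHS](sn m.+1); congr s; apply/funext => k.
by rewrite mulrNz /= subrK.
Qed.

Definition slope (x : Zn) : R := \sum_k ratr (alpha 0 k) * (x 0 k)%:~R.

Lemma slopeD x y : slope (x + y) = slope x + slope y.
Proof.
by rewrite -big_split /=; apply: eq_bigr => k _; rewrite mxE intrD mulrDr.
Qed.

(** This is where the periods are the denominators of [alpha]: along a vector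
of periods the linear part changes by an integer, which the potential does not
see. *)
Lemma slope_period (l : Zn) : (forall k, (P k %| co l k)%Z) ->
  exists c : int, slope l = c%:~R.
Proof.
move=> Pl; exists (\sum_k numq (alpha 0 k) * (co l k %/ P k)%Z).
rewrite raddf_sum /=; apply: eq_bigr => k _.
rewrite -{1}(divzK (Pl k)) intrM mulrCA mulrC intrM; congr (_ * _).
rewrite /per /ratr mulfVK// intr_eq0; exact: denq_neq0.
Qed.

Lemma window_tilt (l j : Zn) (u : conf) (c : int) : slope l = c%:~R ->
  window (r := r) (j + l) (tilt u) =
  fun k => window j (tilt (fun x => u (x + l))) k + c%:~R.
Proof.
move=> lc; apply/funext => k; rewrite /window /Defs.tilt -!/(slope _).
by rewrite -lc (addrA (val k)) (slopeD _ l) addrA.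
Qed.

Lemma Sloc_tilt (l j : Zn) (u : conf) : (forall k, (P k %| co l k)%Z) ->
  Sloc s (j + l) (tilt u) = Sloc s j (tilt (fun x => u (x + l))).
Proof.
move=> /slope_period[c lc].
by rewrite !SlocE (window_tilt j u lc) potential_shift.
Qed.

Lemma Sloc_submodular (j : Zn) (u u' : conf) :
  Sloc s j (tilt (fun x => Num.min (u x) (u' x))) +
  Sloc s j (tilt (fun x => Num.max (u x) (u' x))) <=
  Sloc s j (tilt u) + Sloc s j (tilt u').
Proof.
rewrite !SlocE; have := submodular_of_partials (potential_partials s_adm)
  (potential_second_partials s_adm) (potential_cross_le0 s_adm)
  (window j (tilt u)) (window j (tilt u')).
congr (s _ + s _ <= _); apply/funext => k; rewrite /window /Defs.tilt.
  by rewrite addr_minl.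
by rewrite addr_maxl.
Qed.

Definition lat_layer (x : Zn) : int := (co x ord0 %/ P ord0)%Z.
Definition lat_slide (m : int) (x : Zn) : Zn := x + (m * P ord0) *: evec ord0.
Definition slab_periodic : set conf :=
  [set u | forall k, k != ord0 -> periodic_in alpha k u].

Lemma slide_coord m x k :
  lat_slide m x 0 k = if k == ord0 then x 0 k + m * P ord0 else x 0 k.
Proof.
rewrite /lat_slide /evec !mxE eqxx /=; case: eqP => _; first by rewrite mulr1.
by rewrite mulr0 addr0.
Qed.

Lemma slide_vec_period m k : (P k %| co ((m * P ord0) *: evec ord0 : Zn)%R k)%Z.
Proof.
rewrite /evec !mxE /=; case: eqP => [->|_]; last by rewrite mulr0 dvdz0.
by rewrite mulr1 dvdz_mull.
Qed.

Lemma lat_slide0 x : lat_slide 0 x = x.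
Proof. by rewrite /lat_slide mul0r scale0r addr0. Qed.

Lemma lat_slideD m k x : lat_slide m (lat_slide k x) = lat_slide (m + k) x.
Proof. by rewrite /lat_slide -addrA -scalerDl mulrDl (addrC (k * _)). Qed.

Lemma lat_layer_slide m x : lat_layer (lat_slide m x) = lat_layer x + m.
Proof.
rewrite /lat_layer slide_coord eqxx addrC divzMDl ?(gt_eqF (per_gt0 _))//.
by rewrite addrC.
Qed.

Lemma T1E i x : T1 alpha i x <->
  lat_layer x = i /\ forall k, k != ord0 -> 0 <= x 0 k < P k.
Proof.
have P0 := per_gt0 ord0.
have E : (i * P ord0 <= x 0 ord0 < (i + 1) * P ord0) = (lat_layer x == i).
  rewrite /lat_layer; have := ltz_pmod (x 0 ord0) P0.
  have := modz_ge0 (x 0 ord0) (lt0r_neq0 P0).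
  have := divz_eq (x 0 ord0) (P ord0).
  set q := (_ %/ _)%Z; set m := (_ %% _)%Z => e h1 h2.
  apply/idP/eqP => [|<-]; last by apply/andP; split; nia.
  move=> /andP[h3 h4].
  have [|[//|]] : q <= i - 1 \/ q = i \/ q >= i + 1 by lia.
    by nia.
  by nia.
by rewrite /T1 /= E; split=> -[/eqP li xb]; split => //; exact/eqP.
Qed.

Lemma lat_layer_near x y : norm1 y <= r%:Z ->
  lat_layer x - r%:Z <= lat_layer (y + x) <= lat_layer x + r%:Z.
Proof.
move=> yr; have := le_trans (coord_le_norm1 y ord0) yr.
have P0 := per_gt0 ord0; rewrite /lat_layer mxE.
have := ltz_pmod (x 0 ord0) P0; have := modz_ge0 (x 0 ord0) (lt0r_neq0 P0).
have := divz_eq (x 0 ord0) (P ord0).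
set X := x 0 ord0; set Y := y 0 ord0.
have := ltz_pmod (Y + X) P0; have := modz_ge0 (Y + X) (lt0r_neq0 P0).
have := divz_eq (Y + X) (P ord0).
set q := (X %/ _)%Z; set m := (X %% _)%Z; set q' := (_ %/ _)%Z.
set m' := (_ %% _)%Z => e h1 h2 e' h1' h2' Yr.
have Yr' : - r%:Z <= Y <= r%:Z by lia.
move: Yr' => /andP[Y1 Y2]; clear Yr yr; apply/andP; split.
  rewrite leNgt; apply/negP => lt.
  have : (q - q') * P ord0 >= (r%:Z + 1) * P ord0 by rewrite ler_wpM2r; lia.
  nia.
rewrite leNgt; apply/negP => lt.
have : (q' - q) * P ord0 >= (r%:Z + 1) * P ord0 by rewrite ler_wpM2r; lia.
nia.
Qed.

Local Notation E := (J1i s alpha).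

Lemma energyE i u :
  E i u = \sum_(j <- fset_set (T1 alpha i)) Sloc s j (tilt u) - c0 s alpha.
Proof. by rewrite /J1i fsbig_finite//; exact: finite_T1. Qed.

Lemma mem_T1 i j : (j \in fset_set (T1 alpha i)) = `[< T1 alpha i j >].
Proof. by rewrite in_fset_set ?inE//; exact: finite_T1. Qed.

Lemma slide_T1_bij i m :
  set_bij (T1 alpha i) (T1 alpha (i + m)) (lat_slide m).
Proof.
split.
- move=> j /T1E[ji jb]; apply/T1E; rewrite lat_layer_slide ji.
  by split => // k k0; rewrite slide_coord (negbTE k0); exact: jb.
- by move=> j j' _ _ /addIr.
- move=> j /T1E[ji jb]; exists (lat_slide (- m) j).
    apply/T1E; rewrite lat_layer_slide ji addrK; split => // k k0.
    by rewrite slide_coord (negbTE k0); exact: jb.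
  by rewrite lat_slideD subrr lat_slide0.
Qed.

Lemma lat_energy_slide i m u : E i (fun x => u (lat_slide m x)) = E (i + m) u.
Proof.
rewrite /J1i; congr (_ - _).
rewrite (reindex_fsbig _ _ _ _ (slide_T1_bij i m)).
apply: eq_fsbigr => j _; rewrite [in RHS]/lat_slide Sloc_tilt//.
exact: slide_vec_period.
Qed.

Lemma lat_energy_local i u u' :
  (forall x, i - r%:Z <= lat_layer x <= i + r%:Z -> u x = u' x) ->
  E i u = E i u'.
Proof.
move=> uu'; rewrite !energyE; congr (_ - _); apply: eq_big_seq => j.
rewrite mem_T1 => /asboolP/T1E[ji _]; rewrite !SlocE; congr s.
apply/funext => k; rewrite /window /Defs.tilt uu'//.
by have := lat_layer_near j (stencil_norm k); rewrite ji.
Qed.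

Lemma lat_energy_submodular i u u' :
  E i (fun x => Num.min (u x) (u' x)) + E i (fun x => Num.max (u x) (u' x)) <=
  E i u + E i u'.
Proof.
rewrite !energyE addrACA [leRHS]addrACA lerD2r -!big_split /=.
by apply: ler_sum => j _; exact: Sloc_submodular.
Qed.

Lemma evec_other k l : l != k -> co (evec k : Zn) l = 0.
Proof. by move=> lk; rewrite /evec mxE (negbTE lk) andbF. Qed.

Lemma lat_layer_evec k x c : k != ord0 ->
  lat_layer (x + c *: evec k) = lat_layer x.
Proof.
move=> k0; rewrite /lat_layer mxE [X in (_ + X)%R]mxE.
rewrite evec_other ?mulr0 ?addr0//.
by rewrite eq_sym.
Qed.

Lemma slab_periodic_min u u' : slab_periodic u -> slab_periodic u' ->
  slab_periodic (fun x => Num.min (u x) (u' x)).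
Proof. by move=> Pu Pu' k k0 x; rewrite Pu// Pu'. Qed.

Lemma slab_periodic_max u u' : slab_periodic u -> slab_periodic u' ->
  slab_periodic (fun x => Num.max (u x) (u' x)).
Proof. by move=> Pu Pu' k k0 x; rewrite Pu// Pu'. Qed.

Lemma slab_periodic_glue p u u' : slab_periodic u -> slab_periodic u' ->
  slab_periodic (fun x => if lat_layer x < p then u x else u' x).
Proof. by move=> Pu Pu' k k0 x; rewrite lat_layer_evec// Pu// Pu'. Qed.

Lemma slab_periodic_reindex (f : int -> int) u : slab_periodic u ->
  slab_periodic (fun x => u (lat_slide (f (lat_layer x)) x)).
Proof.
by move=> Pu k k0 x; rewrite lat_layer_evec// /lat_slide addrAC Pu.
Qed.

Lemma T1_0 : T1 alpha 0 = box0 alpha.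
Proof.
apply/seteqP; split => j; rewrite /T1 /box0 /= mul0r add0r mul1r.
  by move=> [j0 jb] k; have [->|/jb] := eqVneq k ord0.
by move=> jb; split.
Qed.

Lemma slab_periodic_Gamma0 u : slab_periodic u ->
  (forall x, u (lat_slide 1 x) = u x) -> Gamma0 alpha u.
Proof.
move=> Pu u1 k; have [->|k0] := eqVneq k ord0; last exact: Pu.
by move=> x; rewrite -[RHS]u1 /lat_slide mul1r.
Qed.

Lemma Gamma0_slab_periodic u : Gamma0 alpha u ->
  slab_periodic u /\ forall x, u (lat_slide 1 x) = u x.
Proof.
move=> Gu; split; first by move=> k _; exact: Gu.
by move=> x; rewrite /lat_slide mul1r; exact: Gu.
Qed.

Lemma energy_J0 u : E 0 u = J0 s alpha (tilt u) - c0 s alpha.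
Proof. by rewrite /J1i T1_0. Qed.

Lemma lat_energy_ge0 u : slab_periodic u ->
  (forall x, u (lat_slide 1 x) = u x) -> 0 <= E 0 u.
Proof.
move=> Pu u1; rewrite energy_J0 subr_ge0; apply: ge_inf; last first.
  by exists u => //; exact: slab_periodic_Gamma0.
have [_ _ [[m sm] _] _] := s_adm.
exists (\sum_(j <- fset_set (box0 alpha)) m) => _ [u' _ <-].
rewrite /J0 fsbig_finite; last exact: finite_box0.
by apply: ler_sum => j _; exact: sm.
Qed.

Definition lattice_layered : layered R Zn :=
  @Layered R Zn lat_layer lat_slide lat_slide0 lat_slideD lat_layer_slide r E
    lat_energy_slide lat_energy_local lat_energy_submodular slab_periodic
    slab_periodic_min slab_periodic_max slab_periodic_glue
    slab_periodic_reindex lat_energy_ge0.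

Lemma N0_ground u : N0 s alpha u <-> ground lattice_layered u.
Proof.
split.
  move=> [/Gamma0_slab_periodic[Pu u1] Ju]; split => //.
  by rewrite /= energy_J0 Ju subrr.
move=> [Pu u1 /= Eu]; split; first exact: slab_periodic_Gamma0.
by apply/eqP; rewrite -subr_eq0 -energy_J0 Eu.
Qed.

Lemma periodic_in_mul k (u : conf) x (m : int) : periodic_in alpha k u ->
  u (x + (m * P k) *: evec k) = u x.
Proof.
move=> uk; have un (c : nat) y : u (y + (c%:Z * P k) *: evec k) = u y.
  elim: c y => [|c IH] y; first by rewrite mul0r scale0r addr0.
  by rewrite intS mulrDl mul1r scalerDl addrA IH uk.
case: m => c; first exact: un.
by rewrite NegzE mulNr scaleNr -[LHS](un c.+1) subrK.
Qed.

Lemma slab_periodic_congr u x y : slab_periodic u -> co x ord0 = co y ord0 ->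
  (forall k, k != ord0 -> (P k %| co x k - co y k)%Z) -> u x = u y.
Proof.
move=> Pu xy0 xyk; have -> : x = y + (x - y) by rewrite addrC subrK.
have d0 : co (x - y) ord0 = 0 by rewrite !mxE xy0 subrr.
have dk k : k != ord0 -> (P k %| co (x - y)%R k)%Z by rewrite !mxE; exact: xyk.
move: (x - y) d0 dk => d d0 dk; rewrite [d]row_sum_delta -big_enum /=.
elim: (enum _) y {xy0 xyk} => [|k l IH] y; first by rewrite big_nil addr0.
rewrite big_cons addrA IH; have [->|k0] := eqVneq k ord0.
  by rewrite d0 scale0r addr0.
by rewrite -(divzK (dk k k0)) periodic_in_mul//; exact: Pu.
Qed.

(** The representative of [y], modulo the periods of all directions but the
first, in the fundamental domain of its layer. *)
Definition reduce (y : Zn) : Zn :=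
  \row_k (if k == ord0 then y 0 k else (co y k %% P k)%Z).

Lemma reduce_T1 y : T1 alpha (lat_layer y) (reduce y).
Proof.
apply/T1E; rewrite /lat_layer mxE eqxx; split => // k k0.
by rewrite mxE (negbTE k0) modz_ge0 ?ltz_pmod ?(gt_eqF (per_gt0 k)) ?per_gt0.
Qed.

Lemma reduce_dvd k y : k != ord0 -> (P k %| co y k - co (reduce y) k)%Z.
Proof.
by move=> k0; rewrite mxE (negbTE k0) -eqz_mod_dvd modz_mod.
Qed.

Lemma slab_periodic_reduce u y : slab_periodic u -> u (reduce y) = u y.
Proof.
move=> Pu; apply/esym/slab_periodic_congr => //; first by rewrite mxE eqxx.
by move=> k k0; exact: reduce_dvd.
Qed.

Definition orbit (i : Zn) : pred Zn := fun x =>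
  (co x ord0 == co i ord0) &&
  [forall k, (k != ord0) ==> (P k %| co x k - co i k)%Z].

Lemma orbitP i x : reflect (co x ord0 = co i ord0 /\
  forall k, k != ord0 -> (P k %| co x k - co i k)%Z) (orbit i x).
Proof.
apply: (iffP andP) => [[/eqP x0 /forallP xk]|[x0 xk]]; split => //.
- by move=> k k0; exact: (implyP (xk k)).
- exact/eqP.
- by apply/forallP => k; apply/implyP; exact: xk.
Qed.

Lemma orbit_periodic i k x : k != ord0 ->
  orbit i (x + P k *: evec k) = orbit i x.
Proof.
move=> k0; have e l : co (x + P k *: evec k)%R l - co i l =
    co x l - co i l + (if l == k then P k else 0).
  rewrite /evec !mxE /=; case: eqP => _; rewrite ?mulr1 ?mulr0; ring.
apply/orbitP/orbitP => -[x0 xk].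
  split; first by have := e ord0; rewrite x0 eq_sym (negbTE k0) /=; lia.
  move=> l l0; have := xk l l0; rewrite e.
  case: eqP => [->|_]; last by rewrite addr0.
  by rewrite rpredDr ?dvdzz.
split; first by have := e ord0; rewrite x0 eq_sym (negbTE k0) /=; lia.
move=> l l0; have := xk l l0; rewrite e.
case: eqP => [->|_]; last by rewrite addr0.
by move=> h; apply: rpredD => //; exact: dvdzz.
Qed.

Lemma orbit_stencil i l x j :
  T1 alpha l j -> orbit i (x + j) -> j = reduce (i - x).
Proof.
move=> /T1E[_ jb] /orbitP[x0 xk]; apply/rowP => k; rewrite !mxE.
case: eqVneq => [->|k0]; first by move: x0; rewrite !mxE => <-; ring.
have /andP[j0 jP] := jb k k0; rewrite -[LHS](modz_small (d := P k)); last first.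
  by rewrite j0 jP.
apply/eqP; rewrite eqz_mod_dvd; have := xk k k0; rewrite !mxE.
by congr (_ %| _)%Z; ring.
Qed.

Lemma orbit_reduce i x : orbit i (x + reduce (i - x)).
Proof.
apply/orbitP; split; first by rewrite !mxE eqxx; ring.
move=> k k0; have := reduce_dvd (i - x) k0; rewrite -rpredN.
by rewrite !mxE (negbTE k0); congr (_ %| _)%Z; ring.
Qed.

Definition raise (i : Zn) (t : R) (u : conf) : conf :=
  fun x => if orbit i x then u x + t else u x.

Lemma slab_periodic_raise i t u :
  slab_periodic u -> slab_periodic (raise i t u).
Proof. by move=> Pu k k0 x; rewrite /raise orbit_periodic// Pu. Qed.

Definition increment (u : conf) (t : R) (j : Zn) (k : B) : R :=
  s (upd (window j (tilt u)) k (window j (tilt u) k + t)) -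
  s (window j (tilt u)).

Lemma increment_reduce u t j k : slab_periodic u ->
  increment u t (reduce j) k = increment u t j k.
Proof.
move=> Pu; have [c cP] : exists c : int, slope (j - reduce j) = c%:~R.
  apply: slope_period => l; have [->|l0] := eqVneq l ord0.
    by rewrite !mxE eqxx subrr dvdz0.
  by have := reduce_dvd j l0; rewrite !mxE.
have E1 : window (r := r) j (tilt u) =
      fun k => window (reduce j) (tilt u) k + c%:~R.
  have je : j = reduce j + (j - reduce j) by rewrite addrC subrK.
  rewrite {1}je (window_tilt _ _ cP).
  apply/funext => l; rewrite /window /Defs.tilt; congr (_ + _ + _).
  apply: slab_periodic_congr => //.
    by rewrite !mxE eqxx; ring.
  move=> m m0; have := reduce_dvd j m0; rewrite !mxE (negbTE m0).
  by congr (_ %| _)%Z; ring.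
rewrite /increment E1 potential_shift; congr (_ - _).
rewrite -(potential_shift c); congr s; apply/funext => l.
by rewrite !updE; case: eqP => // _; ring.
Qed.

Lemma raise_window i t u j : window (r := r) j (tilt (raise i t u)) =
  fun k => if orbit i (val k + j) then window j (tilt u) k + t
           else window j (tilt u) k.
Proof.
apply/funext => k; rewrite /window /Defs.tilt /raise; case: ifP => // _; ring.
Qed.

Lemma raise_energy_le i t u l : slab_periodic u ->
  E l (raise i t u) - E l u <=
  \sum_(k : B | lat_layer (i - val k) == l) increment u t (i - val k) k.
Proof.
move=> Pu; rewrite !energyE.
have -> (a b c : R) : a - c - (b - c) = a - b by ring.
rewrite -sumrB.
apply: (@le_trans _ _ (\sum_(j <- fset_set (T1 alpha l))
    \sum_(k : B | orbit i (val k + j)) increment u t j k)).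
  apply: ler_sum => j _; rewrite !SlocE raise_window.
  exact: (raise_subadditive (potential_partials s_adm)
    (potential_second_partials s_adm) (potential_cross_le0 s_adm)).
under eq_bigr do rewrite big_mkcond.
rewrite exchange_big [leRHS]big_mkcond /=; apply: ler_sum => k _.
case: eqP => [il|il].
  have jm : reduce (i - val k) \in fset_set (T1 alpha l).
    by rewrite mem_T1; apply/asboolP; rewrite -il; exact: reduce_T1.
  rewrite (bigD1_seq _ jm (fset_uniq _)) /= orbit_reduce increment_reduce//.
  rewrite big1_seq ?addr0// => j /andP[jr]; rewrite mem_T1 => /asboolP jT.
  by case: ifP => // /(orbit_stencil jT) je; rewrite je eqxx in jr.
rewrite big1_seq// => j /andP[_]; rewrite mem_T1 => /asboolP jT.
case: ifP => // /(orbit_stencil jT) je; case: il.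
by have /T1E[<- _] := jT; rewrite je; have /T1E[-> _] := reduce_T1 (i - val k).
Qed.

Local Notation C := lattice_layered.

(** Raising [u] on an orbit costs at most [site_energy]: each window meeting
the orbit in a coordinate [k] contributes at most the sum over such [k] of
single raises, and for each [k] exactly one site of the fundamental domain is
the centre of such a window. By periodicity its contribution equals the one of
the window centred at [i - val k]. *)
Lemma raise_block_le i t u : slab_periodic u ->
  block C (lat_layer i - r%:Z) (1 + 2 * r) (raise i t u) -
  block C (lat_layer i - r%:Z) (1 + 2 * r) u <=
  site_energy s (tilt u) i (tilt u i + t).
Proof.
move=> Pu; rewrite /block -sumrB /=.
apply: (@le_trans _ _ (\sum_(m < 1 + 2 * r)
    \sum_(k : B | lat_layer (i - val k) == lat_layer i - r%:Z + m%:Z)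
      increment u t (i - val k) k)).
  by apply: ler_sum => m _; exact: raise_energy_le.
under eq_bigr do rewrite big_mkcond.
rewrite exchange_big /=; apply: ler_sum => k _.
set L := lat_layer (i - val k).
have lk : lat_layer i - r%:Z <= L <= lat_layer i + r%:Z.
  have := @lat_layer_near i (- val k); rewrite norm1N => /(_ (stencil_norm k)).
  by rewrite (addrC (- val k)).
have km : (absz (L - lat_layer i + r%:Z)%R < 1 + 2 * r)%N by lia.
rewrite (bigD1 (Ordinal km))//= -/L ifT; last by lia.
rewrite big1 ?addr0; last first.
  move=> m mk; rewrite -/L; case: eqP => // e; case/negP: mk.
  apply/eqP/val_inj => /=; lia.
by rewrite /increment window_center.
Qed.

End LatticeEnergy.

(** * Minimal connections of the lattice problem *)

Section Main.
Context {R : realType} {n r : nat}.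
Local Notation Zn := 'rV[int]_n.+1.
Local Notation conf := (Zn -> R).
Local Notation B := (B0 (n := n) r).
Variable s : (B -> R) -> R.
Hypothesis s_adm : admissible s.
Variable alpha : 'rV[rat]_n.+1.
Local Notation tilt := (tilt alpha).
Local Notation C := (lattice_layered s_adm alpha).
Local Notation lay := (lat_layer alpha).
Local Notation sh := (lat_slide alpha).

Lemma EL_sum_ge0 (u : conf) i d : 0 < d ->
  (forall t, 0 < t -> t < d -> 0 <= site_energy s u i (u i + t)) ->
  0 <= EL_sum s u i.
Proof.
move=> d0 h; have [dS <-] := site_energy_is_derive s_adm u i.
rewrite -derive1E; apply: derive1_ge0_right_min dS d0 _ => t t0 td.
by rewrite site_energy_self h.
Qed.

Lemma EL_sum_le0 (u : conf) i d : 0 < d ->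
  (forall t, 0 < t -> t < d -> 0 <= site_energy s u i (u i - t)) ->
  EL_sum s u i <= 0.
Proof.
move=> d0 h; have [dS <-] := site_energy_is_derive s_adm u i.
rewrite -derive1E; apply: derive1_le0_left_min dS d0 _ => t t0 td.
by rewrite site_energy_self h.
Qed.

Lemma orbit_layer i x : orbit alpha i x -> lay x = lay i.
Proof. by move=> /orbitP[e _]; rewrite /lat_layer e. Qed.

Lemma raise_off i t (u : conf) x :
  lay x < lay i \/ lay i + 1%:Z <= lay x -> raise alpha i t u x = u x.
Proof. by rewrite /raise; case: ifP => // /orbit_layer ->; lia. Qed.

(** A raised ground state is an excursion, of nonnegative energy for both signs
of [t]; no bounds on the configuration are involved here. *)
Lemma ground_EL z : ground C z -> forall i, EL_sum s (tilt z) i = 0.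
Proof.
move=> zg i; have [Pz _ _] := zg.
have h t : 0 <= site_energy s (tilt z) i (tilt z i + t).
  apply: le_trans (raise_block_le s_adm i t Pz).
  rewrite [X in _ - X](block_ground _ _ zg) subr0.
  apply: (@excursion_ge0 _ _ C (lay i) 1 _ z) => //.
    exact: slab_periodic_raise.
  by move=> x; exact: raise_off.
apply/eqP; rewrite eq_le (@EL_sum_ge0 _ _ 1) ?(@EL_sum_le0 _ _ 1)//.
Qed.

Lemma lat_energy_continuous i :
  continuous (J1i s alpha i : {ptws Zn -> R} -> R).
Proof.
rewrite (_ : J1i s alpha i = fun u =>
  \sum_(j <- fset_set (T1 alpha i)) Sloc s j (tilt u) - c0 s alpha); last first.
  by apply/funext => u; exact: energyE.
move=> u; apply: (@continuousB _ _ {ptws Zn -> R}); last exact: cst_continuous.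
move: u; apply: (@continuous_sumr R {ptws Zn -> R}) => j.
rewrite (_ : (fun u => _) = fun u : conf => s (window j (tilt u))); last first.
  by apply/funext => u; exact: SlocE.
move=> u; apply: (@continuous_comp {ptws Zn -> R} {ptws B -> R} R).
  move: u; apply: (@continuous_pointwise R B {ptws Zn -> R}) => k u.
  apply: (@continuousD _ _ {ptws Zn -> R}); last exact: cst_continuous.
  exact: (@eval_continuous R Zn (val k + j)).
by have [[cs _] _ _ _] := s_adm; exact: cs.
Qed.

Lemma slab_periodic_closed :
  closed (slab_periodic alpha : set {ptws Zn -> R}).
Proof.
rewrite (_ : slab_periodic alpha = [set u : {ptws Zn -> R} |
    forall k : {k | k != ord0}, forall x,
      u (x + per alpha (val k) *: evec (val k)) = u x]).
  apply: closed_forall => k; apply: closed_forall => x.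
  by apply: closed_eq_continuous; exact: eval_continuous.
apply/seteqP; split => u Pu; first by move=> [k k0] x; exact: Pu.
by move=> k k0 x; exact: (Pu (exist _ k k0)).
Qed.

Lemma reduce_base x : exists2 y, T1 alpha 0 y & exists m,
  forall u, slab_periodic alpha u ->
    forall k, u (sh k x) = u (sh (k + m) y) :> R.
Proof.
exists (reduce alpha (sh (- lay x) x)).
  by have := reduce_T1 alpha (sh (- lay x) x); rewrite lat_layer_slide subrr.
exists (lay x) => u Pu k.
have Pk : slab_periodic alpha (fun y => u (sh (k + lay x) y)).
  exact: (slab_periodic_reindex (fun=> k + lay x)).
rewrite (slab_periodic_reduce (sh (- lay x) x) Pk) lat_slideD.
by congr (u (sh _ x)); lia.
Qed.

Variables v0 w0 : conf.
Hypothesis adj : adjacent_in (N0 s alpha) v0 w0.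

Let v0_ground : ground C v0.
Proof. by apply/N0_ground; case: adj. Qed.

Let w0_ground : ground C w0.
Proof. by apply/N0_ground; case: adj. Qed.

Let v0_lt_w0 : clt v0 w0. Proof. by case: adj. Qed.

Lemma lattice_gap_empty u : slab_periodic alpha u ->
  (forall x, v0 x <= u x <= w0 x) ->
  (forall x, u (sh 1 x) = u x) -> J1i s alpha 0 u = 0 -> u = v0 \/ u = w0.
Proof.
move=> Pu uvw u1 Eu; have [_ _ _ nadj] := adj.
apply: contrapT => /not_orP[uv uw]; apply: nadj; exists u; split => //.
- by apply/(N0_ground s_adm).
- by move=> x; have /andP[] := uvw x.
- by move=> x; have /andP[] := uvw x.
Qed.

Definition lattice_gap : gap C.
Proof.
refine (@Gap R Zn C v0 w0 v0_ground w0_ground (fun x => ltW (v0_lt_w0 x))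
  0 (v0_lt_w0 0) lat_energy_continuous slab_periodic_closed
  (fset_set (T1 alpha 0)) _ _ lattice_gap_empty).
- by move=> x; rewrite mem_T1 => /asboolP/T1E[].
- move=> u u' Pu Pu' uu'; apply/funext => x.
  have [y Ty [m uy]] := reduce_base x.
  rewrite -[x](lat_slide0 alpha) !uy//; apply: uu'.
  by rewrite mem_T1; exact/asboolP.
Defined.

Local Notation G := lattice_gap.

Lemma hatGamma1_band u : hatGamma1 alpha v0 w0 u <-> band G u.
Proof.
split => [[vu uw Pu]|[Pu uvw]]; first by split => // x; rewrite vu uw.
by split => // x; have /andP[] := uvw x.
Qed.

Lemma l1on_T1 m (u z : conf) : (forall m x, z (sh m x) = z x) ->
  l1on (T1 alpha m) (fun i => u i - z i) =
  \sum_(y <- fset_set (T1 alpha 0)) `|u (sh m y) - z y|.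
Proof.
move=> zinv; rewrite /l1on.
have := slide_T1_bij alpha 0 m; rewrite add0r => mbij.
rewrite (reindex_fsbig _ _ _ _ mbij) fsbig_finite; last exact: finite_T1.
by apply: eq_bigr => y _; rewrite zinv.
Qed.

(** The norms over the cells of the layers converge to 0 exactly when there is
convergence at every site: a site lies in the orbit of a cell, up to a fixed
number of layers, which the hypothesis on [t] absorbs. *)
Lemma l1on_cvg (t : nat -> int) (u z : conf) : slab_periodic alpha u ->
  slab_periodic alpha z -> (forall m x, z (sh m x) = z x) ->
  (forall (g : int -> R) (l : R) (m : int),
    g (t k) @[k --> \oo] --> l -> g (t k + m) @[k --> \oo] --> l) ->
  l1on (T1 alpha (t k)) (fun i => u i - z i) @[k --> \oo] --> (0 : R) <->
  forall x, u (sh (t k) x) @[k --> \oo] --> z x.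
Proof.
move=> Pu Pz zinv tm; split => [uz x|uz]; last first.
  have h : \sum_(y <- fset_set (T1 alpha 0)) `|u (sh (t k) y) - z y|
      @[k --> \oo] --> \sum_(y <- fset_set (T1 alpha 0)) (0 : R).
    apply: cvg_sumr => y.
    have -> : (0 : R) = `|z y - z y| by rewrite subrr normr0.
    by apply: cvg_norm; apply: cvgB (cvg_cst _); exact: uz.
  rewrite big1// in h; apply: cvg_trans h; apply: near_eq_cvg.
  apply: nearW => k.
  by rewrite (l1on_T1 _ _ zinv).
have [y Ty [m uy]] := reduce_base x.
have -> : z x = z y.
  by have := uy _ Pz 0; rewrite !zinv.
under eq_fun do rewrite uy//.
apply: (tm (fun k => u (sh k y))).
apply/subr_cvg0/norm_cvg0P.
apply: (squeeze_cvgr _ (cvg_cst 0) uz); apply: nearW => k.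
rewrite normr_ge0 /= (l1on_T1 _ _ zinv).
have yT : y \in fset_set (T1 alpha 0) by rewrite mem_T1; exact/asboolP.
by rewrite (bigD1_seq _ yT (fset_uniq _)) /= lerDl sumr_ge0.
Qed.

Lemma Gamma1_connection u : Gamma1 alpha v0 w0 u <-> connection G u.
Proof.
have [Pv _ _] := v0_ground; have [Pw _ _] := w0_ground.
have neg (g : int -> R) (l : R) (m : int) :
    g (- k%:Z) @[k --> \oo] --> l -> g (- k%:Z + m) @[k --> \oo] --> l.
  move=> /(@cvg_int_shift R (fun k => g (- k)) l (- m)).
  by under eq_fun do rewrite opprD opprK.
split=> [[/hatGamma1_band bu uv uw]|[bu uv uw]]; have [Pu _] := bu.
  by split => //; apply/l1on_cvg => //;
    [exact: (lower_slide G)|exact: (upper_slide G)|exact: cvg_int_shift].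
split; first exact/hatGamma1_band.
  by apply/l1on_cvg => //; exact: (lower_slide G).
by apply/l1on_cvg => //; [exact: (upper_slide G)|exact: cvg_int_shift].
Qed.

Lemma J1pq_partial_sum u (x : nat * nat) :
  J1pq s alpha (- x.1%:Z) x.2%:Z u = partial_sum (C := C) u x.
Proof.
rewrite /J1pq /partial_sum /block.
rewrite (reindex_fsbig (fun k : nat => - x.1%:Z + k%:Z) `I_(x.1 + x.2).+1).
  symmetry.
  by apply: (fsbig_ord _ _ (fun k : nat => J1i s alpha (- x.1%:Z + k%:Z) u)).
split.
- by move=> k /=; lia.
- by move=> k k' _ _ /=; lia.
- move=> i /= ix; exists (absz (i + x.1%:Z)%R) => /=; lia.
Qed.

Lemma J1E u : J1 s alpha u = limf_einf (fun x => (partial_sum (C := C) u x)%:E)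
  (filter_prod \oo \oo).
Proof.
rewrite /J1; congr (limf_einf _ _); apply/funext => x.
by rewrite J1pq_partial_sum.
Qed.

Lemma minimal_J1 u : minimal G u -> J1 s alpha u = (least_cost G)%:E.
Proof.
move=> mu; have [cu _] := mu; rewrite J1E; apply/eqP; rewrite eq_le.
apply/andP; split; first by apply: limf_einf_le => e; exact: minimal_near.
by apply: limf_einf_ge => e; exact: partial_sum_ge_near.
Qed.

Lemma c1E : c1 s alpha v0 w0 = (least_cost G)%:E.
Proof.
apply/eqP; rewrite eq_le; apply/andP; split.
  have [U mU] := minimal_exists G; apply: ge_ereal_inf.
  exists (J1 s alpha U); last by rewrite minimal_J1.
  by exists U => //; apply/Gamma1_connection; case: mU.
apply/ereal_infP => _ [u /Gamma1_connection cu <-]; rewrite J1E.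
by apply: limf_einf_ge => e; exact: partial_sum_ge_near.
Qed.

Lemma M1_minimal u : M1 s alpha v0 w0 u <-> minimal G u.
Proof.
split=> [[/Gamma1_connection cu]|mu].
  rewrite c1E J1E => Ju; apply: minimal_of_frequently => // e K e0.
  by apply: limf_einf_frequently => //; rewrite Ju.
by split; [apply/Gamma1_connection; case: mu|rewrite c1E minimal_J1].
Qed.

Lemma minimal_raise U i t : minimal G U -> v0 i <= U i + t <= w0 i ->
  0 <= site_energy s (tilt U) i (tilt U i + t).
Proof.
move=> mU ti; have [[[PU Uvw] _ _] _] := mU.
have [Pv _ _] := v0_ground; have [Pw _ _] := w0_ground.
apply: le_trans (raise_block_le s_adm i t PU); rewrite subr_ge0.
apply: (@minimal_local _ _ _ G (lay i) 1 U) => //; last first.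
  by move=> x; exact: raise_off.
split; first exact: slab_periodic_raise.
move=> x; rewrite /raise; case: ifP => [/orbitP[x0 xk]|_]; last exact: Uvw.
by rewrite /= !(@slab_periodic_congr _ _ alpha _ x i).
Qed.

(** At a site where [U] lies above [v0] it can be lowered, which gives one
inequality; where it touches [v0] that inequality is the comparison
[EL_sum_le] with the solution [v0]. The other one is symmetric, with [w0]. *)
Lemma minimal_EL U : minimal G U -> EL_solution s (tilt U).
Proof.
move=> mU; apply/(EL_solutionE s) => i.
have [[[PU Uvw] _ _] _] := mU; have /andP[vU Uw] := Uvw i.
rewrite /= in vU Uw.
apply/eqP; rewrite eq_le; apply/andP; split.
  have [vU'|vU'] : v0 i = U i \/ v0 i < U i
    by apply/predU1P; rewrite -le_eqVlt.
    rewrite -(ground_EL v0_ground i); apply: (EL_sum_le s_adm).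
      by move=> x; rewrite /Defs.tilt lerD2r; have /andP[] := Uvw x.
    by rewrite /Defs.tilt vU'.
  apply: (@EL_sum_le0 _ _ (U i - v0 i)); first by rewrite subr_gt0.
  by move=> t t0 td; apply: minimal_raise => //; apply/andP; split; lra.
have [Uw'|Uw'] : U i = w0 i \/ U i < w0 i by apply/predU1P; rewrite -le_eqVlt.
  rewrite -(ground_EL w0_ground i); apply: (EL_sum_le s_adm).
    by move=> x; rewrite /Defs.tilt lerD2r; have /andP[] := Uvw x.
  by rewrite /Defs.tilt Uw'.
apply: (@EL_sum_ge0 _ _ (w0 i - U i)); first by rewrite subr_gt0.
by move=> t t0 td; apply: minimal_raise => //; apply/andP; split; lra.
Qed.

Hypothesis r_gt0 : (0 < r)%N.

Lemma minimal_touch U V i : minimal G U -> minimal G V -> cle U V ->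
  U i = V i -> U = V.
Proof.
move=> mU mV UV Ui; have tUV : tilt U = tilt V.
  apply: (EL_comparison s_adm r_gt0 (minimal_EL mU) (minimal_EL mV) (i := i)).
    by move=> x; rewrite /Defs.tilt lerD2r.
  by rewrite /Defs.tilt Ui.
by apply/funext => x; have := congr1 (@^~ x) tUV; rewrite /Defs.tilt => /addIr.
Qed.

(** If [U <= V] at some site, the minimum of both, a minimiser, touches [U]
there and so equals [U]. *)
Lemma minimal_ordered U V : minimal G U -> minimal G V ->
  [\/ clt U V, U = V | clt V U].
Proof.
move=> mU mV; have [mm _] := minimal_min_max mU mV.
have mle x : cmin U V x <= U x by rewrite /cmin ge_min lexx.
have [[i Ui]|nUi] := pselect (exists i, U i <= V i); last first.
  by constructor 3 => x; rewrite ltNge; apply/negP => Ux; apply: nUi; exists x.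
have mUE : cmin U V = U.
  apply: (@minimal_touch _ _ i) => //.
  by rewrite /cmin; apply/min_idPl.
have UV x : U x <= V x by rewrite -{1}mUE /cmin ge_min lexx orbT.
have [[j Uj]|nUj] := pselect (exists j, U j = V j).
  by constructor 2; exact: (minimal_touch (i := j)).
constructor 1 => x; rewrite lt_neqAle UV andbT; apply/eqP => Ux.
by apply: nUj; exists x.
Qed.

(** The other two cases would make [U] nonincreasing along the first
direction, against its limits [v0 < w0]. *)
Lemma minimal_increasing U : minimal G U -> clt U (tau ord0 (per alpha ord0) U).
Proof.
move=> mU; have mU' := minimal_translate mU.
have tauE : tau ord0 (per alpha ord0) U = translate C 1 U.
  by apply/funext => x; rewrite /tau /translate /= /lat_slide mul1r.
have [[_ Uv Uw] _] := mU.
have [_ _ vw _] := adj.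
have not_dec : ~ forall x, U (sh 1 x) <= U x.
  move=> dec; have mono (k : nat) x : U (sh k%:Z x) <= U x.
    elim: k => [|k IH]; first by rewrite lat_slide0.
    apply: le_trans IH; have -> : k.+1%:Z = 1 + k%:Z by lia.
    by rewrite -(lat_slideD alpha 1); exact: dec.
  have w0U : w0 0 <= U 0.
    apply: (@closed_cvg _ _ _ _ _ (fun y : R => y <= U 0) _ _ _ (Uw 0)).
      exact: closed_le.
    by apply: nearW => k; exact: mono.
  have Uv0 : U 0 <= v0 0.
    apply: (@closed_cvg _ _ _ _ _ (fun y : R => U 0 <= y) _ _ _ (Uv 0)).
      exact: closed_ge.
    apply: nearW => k /=; have := mono k (sh (- k%:Z) 0).
    by rewrite lat_slideD subrr lat_slide0.
  by have := v0_lt_w0 0; rewrite ltNge (le_trans w0U Uv0).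
rewrite tauE; case: (minimal_ordered mU mU') => // [UE|Ugt]; exfalso.
  by apply: not_dec => x; rewrite -[U (sh 1 x)]/(translate C 1 U x) -UE.
by apply: not_dec => x; exact: ltW (Ugt x).
Qed.

End Main.

Theorem theorem5p8 (R : realType) (n r : nat) (r_gt0 : (0 < r)%N)
    (s : (B0 (n := n) r -> R) -> R) (s_adm : admissible s)
    (alpha : 'rV[rat]_n.+1) (v0 w0 : 'rV[int]_n.+1 -> R)
    (adj : adjacent_in (N0 s alpha) v0 w0) :
  [/\ exists2 U1, M1 s alpha v0 w0 U1 & EL_solution s (tilt alpha U1),
      cordered (M1 s alpha v0 w0),
      forall U, M1 s alpha v0 w0 U -> EL_solution s (tilt alpha U) &
      forall U, M1 s alpha v0 w0 U -> clt U (tau ord0 (per alpha ord0) U)].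
Proof.
have M1P := M1_minimal s_adm adj.
split.
- have [U mU] := minimal_exists (lattice_gap s_adm adj).
  by exists U; [exact/M1P|exact: minimal_EL mU].
- move=> U V /M1P mU /M1P mV; exact (minimal_ordered r_gt0 mU mV).
- by move=> U /M1P; exact: minimal_EL.
- move=> U /M1P mU; exact (minimal_increasing r_gt0 mU).
Qed.
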